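(* Let $\lambda$ be a regular cardinal with $\lambda>\beth_\omega$. Then there is a cardinal $\kappa_0<\beth_\omega$ such that for every regular cardinal $\kappa$ with $\kappa_0\le\kappa<\beth_\omega$ the following three statements hold: (1) If $\lambda^{<\kappa}=\lambda$, then $\clubsuit^-(S^\lambda_\kappa)$ holds. Precisely, there is a sequence $\langle\mathcal{P}_\delta:\,\delta\in S^\lambda_\kappa\rangle$ such that (i) each $\mathcal{P}_\delta$ is a family of fewer than $\lambda$ elements of $[\delta]^{\le\kappa}$, and (ii) for every $A\in[\lambda]^\lambda$ there are stationarily many $\delta\in S^\lambda_\kappa$ such that for some $X\in\mathcal{P}_\delta$ we have $X\subseteq A$ and $\sup(X)=\delta$. (2) There is a sequence $\langle\mathcal{P}^0_\delta:\,\delta\in S^\lambda_\kappa\rangle$ such that each $\mathcal{P}^0_\delta$ is a family of fewer than $\lambda$ elements of $[\delta]^{\le\kappa}$, and for every $A\in[\lambda]^\lambda$ there is a club $E$ of $\lambda$ such that for every $\delta\in E\cap S^\lambda_\kappa$ there is $a\in\mathcal{P}^0_\delta$ with $\sup(A\cap a)=\delta$. (3) If for every cardinal $\theta<\lambda$ we have $\theta^{<\kappa}<\lambda$, then there is a sequence $\langle\mathcal{R}_\delta:\,\delta\in S^\lambda_\kappa\rangle$ such that each $\mathcal{R}_\delta$ is a family of fewer than $\lambda$ elements of $[\delta]^{\le\kappa}$, and for every sequence $\langle a_\delta:\,\delta\in S^\lambda_\kappa\rangle$ of sets such that each $a_\delta$ is a subset of $\delta$ of order type $\le\kappa$, there is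 a club $C$ of $\lambda$ such that $a_\delta\in\mathcal{R}_\delta$ for every $\delta\in C\cap S^\lambda_\kappa$.
   Context: For a regular cardinal $\kappa$ and an ordinal $\alpha>\kappa$, $S^\alpha_\kappa=\{\beta<\alpha:\,\mathrm{cf}(\beta)=\kappa\}$. For a set $X$ and cardinal $\nu$, $[X]^{\le\nu}$ (resp. $[X]^{\nu}$) is the set of subsets of $X$ of size $\le\nu$ (resp. exactly $\nu$). For a stationary $S\subseteq\lambda$, $\clubsuit^-(S)$ is the statement that there is a sequence $\langle\mathcal{P}_\delta:\,\delta\in S\rangle$ where each $\mathcal{P}_\delta$ is a family of fewer than $\lambda$ subsets of $\delta$, such that for every unbounded $A\subseteq\lambda$ there are stationarily many $\delta\in S$ for which some $X\in\mathcal{P}_\delta$ with $\sup(X)=\delta$ satisfies $X\subseteq A$. *)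

(* Defs.v *)
(* Cardinals are represented by types (compared by injections),
   ordinals/initial ordinals by well-ordered types. *)
From Stdlib Require Import Relations Wellfounded.

Definition card_le (A B : Type) : Prop :=
  exists f : A -> B, forall x y, f x = f y -> x = y.
Definition card_lt (A B : Type) : Prop := card_le A B /\ ~ card_le B A.
Definition card_eq (A B : Type) : Prop := card_le A B /\ card_le B A.

(* beth_n: beth 0 = aleph_0, beth (n+1) = 2^(beth n) (power set as Prop-valued
   predicates); beth_omega = sup_n beth_n = |disjoint union of the beth_n|. *)
Fixpoint beth_type (n : nat) : Type :=
  match n with
  | O => nat
  | S m => beth_type m -> Prop
  end.
Definition beth_omega : Type := { n : nat & beth_type n }.

Set Implicit Arguments.
Section Ord.
Variables (T : Type) (lt : T -> T -> Prop).
Definition le (x y : T) : Prop := lt x y \/ x = y.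

Definition strict_wellorder : Prop :=
  (forall x, ~ lt x x) /\
  (forall x y z, lt x y -> lt y z -> lt x z) /\
  (forall x y, lt x y \/ x = y \/ lt y x) /\
  well_founded lt.

Definition below (d : T) : Type := { b : T | lt b d }.

Definition initial_ordinal : Prop :=
  strict_wellorder /\ forall d : T, card_lt (below d) T.

Definition unbounded (X : T -> Prop) : Prop :=
  forall b, exists x, X x /\ le b x.

Definition regular_cardinal : Prop :=
  initial_ordinal /\ card_le nat T /\
  forall X : T -> Prop, unbounded X -> card_le T {x | X x}.

Definition cofinal_in (X : T -> Prop) (d : T) : Prop :=
  (forall x, X x -> lt x d) /\ (forall b, lt b d -> exists x, X x /\ le b x).

Definition cof_eq (d : T) (K : Type) : Prop :=
  (exists X, cofinal_in X d /\ card_eq {x | X x} K) /\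
  (forall Y, cofinal_in Y d -> card_le K {x | Y x}).

Definition sup_eq (X : T -> Prop) (d : T) : Prop :=
  (forall x, X x -> le x d) /\ (forall b, lt b d -> exists x, X x /\ lt b x).

Definition closed_set (C : T -> Prop) : Prop :=
  forall d, (exists b, lt b d) ->
    (forall b, lt b d -> exists g, C g /\ lt b g /\ lt g d) -> C d.
Definition club (C : T -> Prop) : Prop := unbounded C /\ closed_set C.
Definition stationary (S : T -> Prop) : Prop :=
  forall C, club C -> exists d, C d /\ S d.

Definition subset (X Y : T -> Prop) : Prop := forall x, X x -> Y x.

Definition small_subset_of (X : T -> Prop) (d : T) (K : Type) : Prop :=
  subset X (fun b => lt b d) /\ card_le {x | X x} K.

Definition good_family (P : (T -> Prop) -> Prop) (d : T) (K : Type) : Prop :=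
  card_lt {X | P X} T /\ forall X, P X -> small_subset_of X d K.

Definition otype_le (X : T -> Prop) (K : Type) (ltK : K -> K -> Prop) : Prop :=
  exists f : {x | X x} -> K,
    forall x y, lt (proj1_sig x) (proj1_sig y) -> ltK (f x) (f y).
End Ord.
Unset Implicit Arguments.

Definition S_cof {T : Type} (lt : T -> T -> Prop) (K : Type) (d : T) : Prop :=
  cof_eq lt d K.

(* mu^{<kappa} = sup_{alpha<kappa} mu^alpha, as the cardinality of the
   disjoint union over alpha < kappa of the functions alpha -> M *)
Definition exp_lt (M : Type) {K : Type} (ltK : K -> K -> Prop) : Type :=
  { a : K & (below ltK a -> M) }.

(* Main.v *)
(* The three items rest on a form of Shelah's revised GCH: for every ordinal [X] there is
   [n] such that, for every [Y] of size below [beth_omega], at most [|X| + beth_omega]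
   subsets of [X] of size below [beth_omega] suffice to cover the range of each
   [g : Y -> X] by [beth_n] of them.

   The revised GCH is proved by induction on [X], in the spirit of Kunen's theorem that an
   ordinal is moved by only finitely many of the ultrapowers attached to measures on
   distinct cardinals.  If [n = 0] fails, there are a countably complete ideal [N] on a
   small [Y] and [|X + beth_omega|^+] functions from [Y] to [X] that are pairwise distinct
   [N]-almost everywhere.  Choose a bound [f] for such a family that cannot be lowered
   further, even piecewise over a countable partition.  Some member [h < f] of the family
   then lies above [|X|] many other members on positive sets, so that [X] is represented
   inside the product of the ordinals [h y], while the almost everywhere distinct families
   below [h] have size at most [|X + beth_omega|].  Covers of the [h y], given by the
   induction hypothesis with a constant [n], combine into a cover of [X].

   As [T] is regular and uncountable, one [n] serves all [d] in [T].  If [K] is regular and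
   larger than [beth_n], a cofinal sequence of length [K] in [d] must meet one of the
   [beth_n] sets covering it in a cofinal set; this gives (1) and (2).  For (3), either
   all powers [Th ^ K] are below [T], and every small subset of [d] can be listed, or the
   hypothesis of (3) fails for all sufficiently large [K]. *)
From Stdlib Require Import ClassicalEpsilon FunctionalExtensionality
  PropExtensionality IndefiniteDescription Wellfounded
  Eqdep Eqdep_dec Lia Cantor.
From Corelib Require Import ssreflect.
Require Import Defs.

Set Bullet Behavior "None".

(** * Extensionality, injections and well-founded recursion *)

Lemma set_ext A (P Q : A -> Prop) : (forall x, P x <-> Q x) -> P = Q.
Proof.
by move=> h; apply: functional_extensionality => x; apply: propositional_extensionality.
Qed.

Lemma sig_ext A (P : A -> Prop) (u v : {x | P x}) :
  proj1_sig u = proj1_sig v -> u = v.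
Proof.
by apply: eq_sig_hprop => x p q; apply: proof_irrelevance.
Qed.

Lemma not_forall_ex A (P : A -> Prop) : ~ (forall x, P x) -> exists x, ~ P x.
Proof. by move=> h; apply: Classical_Pred_Type.not_all_ex_not. Qed.

Lemma card_le_refl A : card_le A A.
Proof. by exists (fun x => x). Qed.

Lemma card_le_trans A B C : card_le A B -> card_le B C -> card_le A C.
Proof.
by move=> [f hf] [g hg]; exists (fun x => g (f x)) => x y /hg /hf.
Qed.

(** Choice turns the relation into a function; this avoids explicit injections into sigma types. *)
Lemma card_le_rel {A B} {R : A -> B -> Prop} :
  (forall a, exists b, R a b) ->
  (forall a a' b, R a b -> R a' b -> a = a') -> card_le A B.
Proof.
move=> /functional_choice [f hf] inj; exists f => x y e.
by apply: (inj x y (f x)); [|rewrite e].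
Qed.

Lemma card_le_surj A B :
  card_le A B -> A -> exists s : B -> A, forall a, exists b, s b = a.
Proof.
move=> [f hf] a0.
have [s hs] : exists s : B -> A, forall b, (exists a, f a = b) -> f (s b) = b.
  apply: (functional_choice (fun b a => (exists a, f a = b) -> f a = b)) => b.
  case: (classic (exists a, f a = b)) => [[a e]|n]; first by exists a.
  by exists a0.
exists s => a; exists (f a); apply: hf; apply: hs; by exists a.
Qed.

Lemma card_le_empty A B : ~ inhabited A -> card_le A B.
Proof.
by move=> n; exists (fun a => match n (inhabits a) with end) => a; case: (n (inhabits a)).
Qed.

Lemma card_le_sub A (P Q : A -> Prop) :
  (forall x, P x -> Q x) -> card_le {x | P x} {x | Q x}.
Proof.
move=> h; exists (fun u => exist _ (proj1_sig u) (h _ (proj2_sig u))).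
by move=> x y [e]; apply: sig_ext.
Qed.

Lemma card_le_proj1 A (P : A -> Prop) : card_le {x | P x} A.
Proof. by exists (@proj1_sig _ _) => x y; apply: sig_ext. Qed.

Lemma card_le_prod A B A' B' :
  card_le A A' -> card_le B B' -> card_le (A * B) (A' * B').
Proof.
move=> [f hf] [g hg]; exists (fun p => (f (fst p), g (snd p))).
by move=> [a b] [a' b'] /= [/hf -> /hg ->].
Qed.

Lemma card_le_sum A B A' B' :
  card_le A A' -> card_le B B' -> card_le (A + B) (A' + B').
Proof.
move=> [f hf] [g hg].
exists (fun p => match p with inl a => inl (f a) | inr b => inr (g b) end).
by move=> [a|b] [a'|b'] //= [] => [/hf ->|/hg ->].
Qed.

Lemma card_le_pow A B : card_le A B -> card_le (A -> Prop) (B -> Prop).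
Proof.
move=> [f hf]; exists (fun P b => exists a, f a = b /\ P a) => P Q e.
apply: set_ext => x; split=> h.
- have : exists a, f a = f x /\ Q a by rewrite -(equal_f e (f x)); exists x.
  by move=> [a [/hf ->]].
- have : exists a, f a = f x /\ P a by rewrite (equal_f e (f x)); exists x.
  by move=> [a [/hf ->]].
Qed.

Lemma cantor A : ~ card_le (A -> Prop) A.
Proof.
move=> [f hf]; pose D x := exists P, f P = x /\ ~ P x.
case: (classic (D (f D))) => h; last by apply: (h); exists D.
by case: (h) => P [/hf ->].
Qed.

(** Transfinite recursion with a choice at each step: [h] is the part of the function already built
    on the predecessors of [a], and [G a h] lists the admissible next values. *)
Lemma greedy A (R : A -> A -> Prop) B (G : forall a, ({q | R q a} -> B) -> B -> Prop) :
  well_founded R -> (forall a h, exists b, G a h b) ->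
  exists f : A -> B, forall a, G a (fun q => f (proj1_sig q)) (f a).
Proof.
move=> wf hG.
have [sel hsel] : exists sel : forall a, ({q | R q a} -> B) -> B,
    forall a h, G a h (sel a h).
  exists (fun a h => proj1_sig (constructive_indefinite_description _ (hG a h))).
  by move=> a h; apply: proj2_sig.
pose F a (rec : forall q, R q a -> B) :=
  sel a (fun q => rec (proj1_sig q) (proj2_sig q)).
exists (Fix wf (fun _ => B) F) => a.
have e : forall x, Fix wf (fun _ => B) F x = F x (fun y _ => Fix wf (fun _ => B) F y).
  apply: Fix_eq => x u v e; congr (F x _).
  by apply: functional_extensionality_dep => q; apply: functional_extensionality_dep.
by rewrite (e a); apply: hsel.
Qed.

Lemma greedy_inj A (R : A -> A -> Prop) B :
  well_founded R -> (forall x y, R x y \/ x = y \/ R y x) ->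
  (forall a, ~ card_le B {q | R q a}) -> card_le A B.
Proof.
move=> wf tot big.
have [a h|f hf] := greedy A R B (fun a h b => forall q, h q <> b) wf.
  apply: NNPP => n; apply: (big a).
  apply: (card_le_rel (R := fun b q => h q = b)) => [b|b b' q <- <- //].
  apply: NNPP => n'; apply: n; exists b => q e; apply: n'; by exists q.
exists f => x y e; case: (tot x y) => [r|[//|r]].
- by case: (hf y (exist _ x r)).
- by case: (hf x (exist _ y r)).
Qed.

Lemma wf_no_descent A (R : A -> A -> Prop) (s : nat -> A) :
  well_founded R -> ~ forall k, R (s (S k)) (s k).
Proof.
move=> wf hs.
have : forall a, forall k, s k <> a.
  move=> a; elim/(well_founded_ind wf): a => a IH k e.
  by apply: (IH (s (S k)) _ (S k)); rewrite -?e.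
by move=> /(_ (s 0) 0); apply.
Qed.

Lemma wf_min A (R : A -> A -> Prop) (P : A -> Prop) :
  well_founded R -> (exists a, P a) -> exists a, P a /\ forall b, R b a -> ~ P b.
Proof.
move=> wf [a]; elim/(well_founded_ind wf): a => a IH pa.
case: (classic (exists b, R b a /\ P b)) => [[b [rb pb]]|n]; first exact: (IH b).
exists a; split=> // b rb pb; apply: n; by exists b.
Qed.

(** * The well-ordering theorem *)

Section Zermelo.
Variables (A : Type) (c : (A -> Prop) -> A).
Hypothesis c_out : forall S, (exists x, ~ S x) -> ~ S (c S).

Definition adjoin (S : A -> Prop) : A -> Prop := fun x => S x \/ x = c S.

(** Zermelo's chain of initial segments. The empty set belongs to it as the union of the empty
    family. *)
Inductive tower : (A -> Prop) -> Prop :=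
| tower_adjoin S : tower S -> tower (adjoin S)
| tower_union F : (forall S, F S -> tower S) -> tower (fun x => exists S, F S /\ S x).

Local Notation "S [<=] S'" := (forall x, S x -> S' x) (at level 70).

Lemma incl_antisym (S S' : A -> Prop) : S [<=] S' -> S' [<=] S -> S = S'.
Proof. by move=> h h'; apply: set_ext => x; split; [apply: h|apply: h']. Qed.

(** The extreme points of the Bourbaki-Witt argument; all tower sets turn out to be extreme, which
    makes the tower a chain. *)
Definition extreme p := forall q, tower q -> q [<=] p -> q = p \/ adjoin q [<=] p.

Lemma extreme_cmp p : extreme p ->
  forall q, tower q -> q [<=] p \/ adjoin p [<=] q.
Proof.
move=> ep q; elim=> [S tS|F tF].
- case=> h; last by right=> x /h; left.
  case: (ep S tS h) => [->|]; [by right|by left].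
- move=> IH.
  case: (classic (forall S, F S -> S [<=] p)) => h.
    by left=> x [S [FS Sx]]; apply: (h S).
  right; case/not_forall_ex: h => S hS x px.
  exists S; have FS : F S by apply: NNPP => n; apply: hS.
  split=> //; case: (IH S FS) => h; last exact: h.
  by case: hS.
Qed.

Lemma tower_extreme p : tower p -> extreme p.
Proof.
elim=> [S tS eS|F tF IH] q tq hq.
- case: (extreme_cmp _ eS q tq) => h; last by left; apply: incl_antisym.
  case: (eS q tq h) => [->|h']; first by right.
  by right=> x /h'; left.
- case: (classic (exists S, F S /\ q [<=] S)) => [[S [FS h]]|n].
  + case: (IH S FS q tq h) => [e|h']; last by right=> x /h' Sx; exists S.
    case: (classic ((fun x => exists S, F S /\ S x) [<=] q)) => hF.
      by left; apply: incl_antisym.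
    right; case/not_forall_ex: hF => x hx.
    have [[S2 [FS2 S2x]] nqx] : (exists S, F S /\ S x) /\ ~ q x.
      by apply: NNPP => n; apply: hx => h2; apply: NNPP => n2; apply: n.
    case: (extreme_cmp _ (IH S FS) S2 (tF _ FS2)) => h2.
      by case: nqx; rewrite e; apply: h2.
    by rewrite e => z /h2 ?; exists S2.
  + left; apply: incl_antisym => // x [S [FS Sx]].
    case: (extreme_cmp _ (IH S FS) q tq) => h; last by apply: h; left.
    by case: n; exists S.
Qed.

Lemma tower_cmp p q : tower p -> tower q -> q [<=] p \/ adjoin p [<=] q.
Proof. by move=> /tower_extreme /extreme_cmp; apply. Qed.

(** The largest tower set that misses [x]. It serves as the set of predecessors of [x], and [x] is
    the point chosen right after it. *)
Definition stage (x : A) : A -> Prop := fun z => exists S, (tower S /\ ~ S x) /\ S z.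

Lemma tower_stage x : tower (stage x).
Proof. by apply: tower_union => S []. Qed.

Lemma stage_out x : ~ stage x x.
Proof. by move=> [S [[_ h] /h]]. Qed.

Lemma stage_c x : x = c (stage x).
Proof.
apply: NNPP => n.
have out : ~ stage x (c (stage x)) by apply: c_out; exists x; apply: stage_out.
apply: out; exists (adjoin (stage x)); split; last by right.
split; first exact/tower_adjoin/tower_stage.
by case=> [/stage_out|/n].
Qed.

(** Tower sets are comparable, and equal stages give equal points because [x = c (stage x)].
    Well-foundedness is an induction over the tower: all predecessors of the new point of [adjoin S]
    lie in [S]. *)
Lemma zermelo_order : strict_wellorder (fun x y => stage y x).
Proof.
split; [exact: stage_out|split; [|split]].
- move=> x y z [S [[tS Sy] Sx]] [S' [[tS' S'z] S'y]]; exists S'; split=> //.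
  case: (tower_cmp S S' tS tS') => h; first by case: Sy; apply: h.
  by apply: h; left.
- move=> x y.
  case: (tower_cmp _ _ (tower_stage y) (tower_stage x)) => h; last first.
    by right; right; apply: h; right; apply: stage_c.
  case: (tower_cmp _ _ (tower_stage x) (tower_stage y)) => h'; last first.
    by left; apply: h'; right; apply: stage_c.
  by right; left; rewrite (stage_c x) (stage_c y) (incl_antisym _ _ h h').
- have acc S : tower S -> forall x, S x -> Acc (fun x y => stage y x) x.
    elim=> [S0 tS IH|F _ IH] x; last by move=> [S1 [FS Sx]]; apply: (IH S1).
    case=> [/IH //|->]; constructor=> y [S' [[tS' nS'] S'y]].
    apply: IH; case: (tower_cmp _ _ tS tS') => h; first exact: h.
    by case: nS'; apply: h; right.
  move=> x; apply: (acc (adjoin (stage x))); first exact/tower_adjoin/tower_stage.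
  by right; apply: stage_c.
Qed.
End Zermelo.

Lemma well_ordering A : exists R : A -> A -> Prop, strict_wellorder R.
Proof.
case: (classic (inhabited A)) => [[a0]|n]; last first.
  exists (fun _ _ => False).
  by split; [|split; [|split]] => x; case: n; exists.
have [c hc] : exists c : (A -> Prop) -> A, forall S, (exists x, ~ S x) -> ~ S (c S).
  apply: (functional_choice (fun S x => (exists x, ~ S x) -> ~ S x)) => S.
  case: (classic (exists x, ~ S x)) => [[x h]|h]; first by exists x.
  by exists a0.
exists (fun x y => stage A c y x); exact: zermelo_order.
Qed.

(** * Cardinal arithmetic *)

Lemma card_le_total A B : card_le A B \/ card_le B A.
Proof.
have [R [irr [tr [tot wf]]]] := well_ordering A.
case: (classic (exists a, card_le B {q | R q a})) => [[a h]|n].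
  by right; apply: card_le_trans h (card_le_proj1 _ _).
left; apply: (greedy_inj A R B wf tot) => a h; apply: n; by exists a.
Qed.

Lemma card_lt_of_not_le A B : ~ card_le B A -> card_lt A B.
Proof. by case: (card_le_total A B). Qed.

(** Hilbert's hotel: the copy of [nat] inside [A] is shifted by one to make room for [None]. *)
Lemma card_le_option A : card_le nat A -> card_le (option A) A.
Proof.
move=> [i hi].
pose R (o : option A) b := match o with
  | None => b = i 0
  | Some a => (exists n, a = i n /\ b = i (S n)) \/ (~ (exists n, a = i n) /\ b = a)
  end.
apply: (card_le_rel (R := R)) => [[a|]|].
- case: (classic (exists n, a = i n)) => [[n e]|n].
    by exists (i (S n)); left; exists n.
  by exists a; right.
- by exists (i 0).
- move=> [a|] [a'|] b //=.
  + move=> [[n [-> ->]]|[n ->]] [[n' [-> e]]|[n' e]].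
    * by case: (hi _ _ e) => ->.
    * by case: n'; rewrite -e; exists (S n).
    * by case: n; exists (S n').
    * by rewrite e.
  + move=> [[n [_ ->]]|[n ->]] e; first by have := hi _ _ e.
    by case: n; exists 0.
  + move=> -> [[n [_ e]]|[n e]]; first by have := hi _ _ e.
    by case: n; exists 0.
Qed.

Lemma card_le_nat_prod : card_le (nat * nat) nat.
Proof.
exists to_nat => x y e; by rewrite -(cancel_of_to x) -(cancel_of_to y) e.
Qed.

(** * Squares of infinite cardinals *)

Section Hessenberg.
Variables (A : Type) (R : A -> A -> Prop).
Hypothesis wo : strict_wellorder R.
Hypothesis infA : card_le nat A.
Hypothesis IH : forall a, card_le nat (below R a) ->
  card_le (below R a * below R a) (below R a).

Let tot : forall x y, R x y \/ x = y \/ R y x := proj1 (proj2 (proj2 wo)).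
Let trans : forall x y z, R x y -> R y z -> R x z := proj1 (proj2 wo).
Let wf : well_founded R := proj2 (proj2 (proj2 wo)).

(** If [A] embeds in a proper segment, or has no infinite one, the claim is immediate. Otherwise
    pairs are well-ordered by their maximum first, so that every segment of pairs embeds in the
    square of a proper segment of [A], and [greedy_inj] applies. *)
Lemma prod_step : card_le (A * A) A.
Proof.
have irr := proj1 wo.
case: (classic (exists a, card_le A (below R a))) => [[a h]|nA].
  have infa : card_le nat (below R a) by apply: card_le_trans infA h.
  apply: card_le_trans (card_le_prod _ _ _ _ h h) _.
  exact: card_le_trans (IH a infa) (card_le_proj1 _ _).
case: (classic (exists a, card_le nat (below R a))) => [[a0 inf0]|nfin]; last first.
  have h : card_le A nat.
    apply: (greedy_inj A R nat wf tot) => a h; apply: nfin; by exists a.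
  apply: card_le_trans (card_le_prod _ _ _ _ h h) _.
  exact: card_le_trans card_le_nat_prod infA.
have [mx hmx] : exists mx : A * A -> A, forall p,
    (mx p = fst p \/ mx p = snd p) /\ ~ R (mx p) (fst p) /\ ~ R (mx p) (snd p).
  apply: (functional_choice (fun p m => (m = fst p \/ m = snd p) /\
    ~ R m (fst p) /\ ~ R m (snd p))) => -[x y] /=.
  case: (tot x y) => [r|[->|r]].
  - exists y; split; first by right.
    by split; [move=> r'; apply: (irr x); apply: trans r r'|apply: irr].
  - by exists y; split; [right|split; apply: irr].
  - exists x; split; first by left.
    by split; [apply: irr|move=> r'; apply: (irr x); apply: trans r' r].
have [R2 [irr2 [tr2 [tot2 wf2]]]] := well_ordering (A * A).
(* Ties between pairs with the same maximum are broken by an arbitrary well-order [R2]. *)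
pose Q p q := R (mx p) (mx q) \/ (mx p = mx q /\ R2 p q).
apply: (greedy_inj _ Q).
- have : forall m p, mx p = m -> Acc Q p; last by move=> h p; apply: h.
  move=> m; elim/(well_founded_ind wf): m => m IHm p.
  elim/(well_founded_ind wf2): p => p IHp e; constructor=> q [r|[e' r]].
    by apply: (IHm (mx q)) => //; rewrite -e.
  by apply: IHp; rewrite ?e'.
- move=> p q; case: (tot (mx p) (mx q)) => [r|[e|r]].
  + by left; left.
  + case: (tot2 p q) => [r|[->|r]]; [by left; right|by right; left|].
    by right; right; right.
  + by right; right; left.
- move=> p h; apply: nA.
  (* [m] is the larger of [mx p] and [a0], so that its segment is infinite and [IH] applies to
     it. *)
  have [m [inf_m hm]] : exists m, card_le nat (below R m) /\
      (forall x, ~ R (mx p) x -> x = m \/ R x m).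
    have le_p x : ~ R (mx p) x -> x = mx p \/ R x (mx p).
      by move=> n; case: (tot x (mx p)) => [|[|]]; auto.
    case: (tot a0 (mx p)) => [r|[e|r]].
    - exists (mx p); split=> //; apply: card_le_trans inf0 _.
      by apply: card_le_sub => x r'; apply: trans r' r.
    - by exists (mx p); rewrite -{1}e.
    - exists a0; split=> // x /le_p [->|r']; right=> //; exact: trans r' r.
  exists m; apply: card_le_trans h _.
  have o : card_le {x | x = m \/ R x m} (below R m).
    apply: card_le_trans _ (card_le_option _ inf_m).
    apply: (card_le_rel (R := fun u o => match o with
      | None => proj1_sig u = m | Some v => proj1_sig u = proj1_sig v end)).
      move=> [x [e|r]]; first by exists None.
      by exists (Some (exist _ x r)).
    by move=> u v [w|] e e'; apply: sig_ext; rewrite e e'.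
  apply: card_le_trans _ (IH m inf_m).
  apply: card_le_trans _ (card_le_prod _ _ _ _ o o).
  have bnd q : Q q p -> forall x, x = fst q \/ x = snd q -> x = m \/ R x m.
    move=> hq x hx; apply: hm => r.
    have [_ [n1 n2]] := hmx q.
    have nx : ~ R (mx q) x by case: hx => ->.
    apply: nx; case: hq => [r'|[-> _] //]; exact: trans r' r.
  exists (fun u => (exist _ (fst (proj1_sig u)) (bnd _ (proj2_sig u) _ (or_introl eq_refl)),
    exist _ (snd (proj1_sig u)) (bnd _ (proj2_sig u) _ (or_intror eq_refl)))).
  move=> [[x y] hu] [[x' y'] hv] /= [e1 e2]; apply: sig_ext => /=.
  by rewrite e1 e2.
Qed.
End Hessenberg.

Lemma below_wellorder A (R : A -> A -> Prop) (P : A -> Prop) :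
  strict_wellorder R ->
  strict_wellorder (fun u v : {x | P x} => R (proj1_sig u) (proj1_sig v)).
Proof.
move=> [irr [tr [tot wf]]]; split; [|split; [|split]].
- by move=> x; apply: irr.
- by move=> x y z; apply: tr.
- move=> x y; case: (tot (proj1_sig x) (proj1_sig y)) => [|[/sig_ext|]]; auto.
- exact: wf_inverse_image.
Qed.

Lemma card_below_below A (R : A -> A -> Prop) a (u : below R a) :
  strict_wellorder R ->
  card_eq (below (fun u v : below R a => R (proj1_sig u) (proj1_sig v)) u)
    (below R (proj1_sig u)).
Proof.
move=> [_ [tr _]]; split.
- exists (fun v => exist (fun b => R b (proj1_sig u)) (proj1_sig (proj1_sig v)) (proj2_sig v)).
  by move=> x y [e]; apply: sig_ext; apply: sig_ext.
- apply: (card_le_rel (R := fun v w => proj1_sig v = proj1_sig (proj1_sig w))).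
    move=> [x r]; by exists (exist _ (exist _ x (tr _ _ _ r (proj2_sig u))) r).
  by move=> x y w e e'; apply: sig_ext; rewrite e e'.
Qed.

Lemma card_le_square A : card_le nat A -> card_le (A * A) A.
Proof.
have [R wo] := well_ordering A => infA.
apply: (prod_step A R wo infA) => a.
elim/(well_founded_ind (proj2 (proj2 (proj2 wo)))): a => a IH infa.
apply: (prod_step _ _ (below_wellorder _ _ _ wo) infa) => u infu.
have [h1 h2] := card_below_below _ _ _ u wo.
apply: card_le_trans (card_le_prod _ _ _ _ h1 h1) _.
apply: card_le_trans _ h2; apply: IH; first exact: (proj2_sig u).
exact: card_le_trans infu h1.
Qed.

Lemma card_le_sigma M I (F : I -> Type) :
  card_le (M * M) M -> card_le I M -> (forall i, card_le (F i) M) ->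
  card_le {i & F i} M.
Proof.
move=> sq [j hj] hF; apply: card_le_trans _ sq.
have [k hk] : exists k : forall i, F i -> M, forall i x y, k i x = k i y -> x = y.
  exists (fun i => proj1_sig (constructive_indefinite_description _ (hF i))).
  by move=> i; exact: (proj2_sig (constructive_indefinite_description _ (hF i))).
exists (fun u => (j (projT1 u), k _ (projT2 u))).
by move=> [i x] [i' x'] /= [/hj e]; subst i' => /hk ->.
Qed.

Lemma card_le_union M I A (F : I -> A -> Prop) :
  card_le (M * M) M -> card_le I M -> (forall i, card_le {a | F i a} M) ->
  card_le {a | exists i, F i a} M.
Proof.
move=> sq hI hF.
apply: card_le_trans _ (card_le_sigma M I (fun i => {a | F i a}) sq hI hF).
apply: (card_le_rel (R := fun a u => proj1_sig a = proj1_sig (projT2 u))).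
  by move=> [a [i h]]; exists (existT _ i (exist _ a h)).
by move=> a a' b e e'; apply: sig_ext; rewrite e e'.
Qed.

Lemma card_le_or M A (P Q : A -> Prop) :
  card_le nat M -> card_le {a | P a} M -> card_le {a | Q a} M ->
  card_le {a | P a \/ Q a} M.
Proof.
move=> inf hP hQ.
have := card_le_union M bool A (fun b => if b then P else Q) (card_le_square _ inf).
move=> H; apply: card_le_trans (H _ _) => [| |[]//].
- by apply: card_le_sub => a [h|h]; [exists true|exists false].
- apply: card_le_trans _ inf; exists (fun b : bool => if b then 1 else 0).
  by move=> [] [].
Qed.

Lemma card_le_image M I A (f : I -> A) :
  card_le I M -> card_le {a | exists i, a = f i} M.
Proof.
move=> h; apply: card_le_trans _ h.
apply: (card_le_rel (R := fun a i => proj1_sig a = f i)) => [[a ha]//|a a' i e e'].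
by apply: sig_ext; rewrite e e'.
Qed.

(** Hartogs' construction inside a well-order of the power set of [M]: the points with at most [M]
    predecessors are kept. If they embedded in [M], the least omitted point would have at most [M]
    predecessors; if no point is omitted, Cantor's theorem is contradicted. *)
Lemma successor_card M : exists (T : Type) (lt : T -> T -> Prop),
  strict_wellorder lt /\ (forall i, card_le (below lt i) M) /\ ~ card_le T M.
Proof.
have [R wo] := well_ordering (M -> Prop).
exists {z | card_le (below R z) M}, (fun u v => R (proj1_sig u) (proj1_sig v)).
split; [exact: below_wellorder|split].
- move=> [z hz]; refine (card_le_trans _ _ _ _ hz).
  exists (fun v => exist (fun b => R b z) (proj1_sig (proj1_sig v)) (proj2_sig v)).
  by move=> x y [e]; do 2 apply: sig_ext.
- move=> h.
  case: (classic (exists z, ~ card_le (below R z) M)) => [ex|n].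
  + have [z [nz hz]] := wf_min _ _ _ (proj2 (proj2 (proj2 wo))) ex.
    apply: nz; apply: card_le_trans _ h; apply: card_le_sub => x /hz.
    exact: NNPP.
  + apply: (cantor M); apply: card_le_trans _ h.
    have hz z : card_le (below R z) M by apply: NNPP => n'; apply: n; exists z.
    by exists (fun z => exist _ z (hz z)) => x y [].
Qed.

(** * Beth numbers *)

(** Equivalent to having size below [beth_omega], by [small_lt_omega] and [lt_omega_small]. *)
Definition small (Y : Type) := exists m, card_le Y (beth_type m).

Lemma card_le_beth m n : m <= n -> card_le (beth_type m) (beth_type n).
Proof.
elim=> [|k _ h]; first exact: card_le_refl.
apply: card_le_trans h _; exists (fun x y => x = y) => x y e.
by have := equal_f e y => /= ->.
Qed.

Lemma nat_le_beth n : card_le nat (beth_type n).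
Proof. by apply: (card_le_beth 0); lia. Qed.

Lemma beth_le_omega n : card_le (beth_type n) beth_omega.
Proof.
exists (fun x => existT _ n x) => x y.
exact: (inj_pair2_eq_dec _ PeanoNat.Nat.eq_dec).
Qed.

Lemma nat_le_omega : card_le nat beth_omega.
Proof. exact: (beth_le_omega 0). Qed.

Lemma small_le A B : card_le A B -> small B -> small A.
Proof. by move=> h [m hm]; exists m; apply: card_le_trans h hm. Qed.

Lemma small_le_omega A : small A -> card_le A beth_omega.
Proof. by move=> [m h]; apply: card_le_trans h (beth_le_omega m). Qed.

Lemma small_prod A B : small A -> small B -> small (A * B).
Proof.
move=> [m hm] [n hn]; exists (max m n).
apply: card_le_trans _ (card_le_square _ (nat_le_beth _)).
apply: card_le_prod; [apply: card_le_trans hm _|apply: card_le_trans hn _];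
  apply: card_le_beth; lia.
Qed.

Lemma small_pow A : small A -> small (A -> Prop).
Proof. by move=> [m hm]; exists (S m); apply: card_le_pow. Qed.

Lemma small_sum A B : small A -> small B -> small (A + B).
Proof.
move=> sA sB; apply: (small_le _ (nat * ((A -> Prop) * (B -> Prop)))).
  exists (fun u => match u with
    | inl a => (0, ((fun x => x = a), (fun _ => False)))
    | inr b => (1, ((fun _ => False), (fun x => x = b))) end).
  move=> [a|a] [b|b] //= [e].
  - by have -> : b = a by rewrite (equal_f e b).
  - by have -> : b = a by rewrite (equal_f e b).
by apply: small_prod; [exists 0; apply: card_le_refl|apply: small_prod; apply: small_pow].
Qed.

Lemma small_fun A B : small A -> small B -> small (A -> B).
Proof.
move=> hA hB; apply: small_le _ (small_pow _ (small_prod _ _ hA hB)).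
exists (fun f p => f (fst p) = snd p) => f g e; apply: functional_extensionality => x.
by have := equal_f e (x, g x) => /= ->.
Qed.

Lemma small_lt_omega A : small A -> card_lt A beth_omega.
Proof.
move=> [m hm]; apply: card_lt_of_not_le => h; apply: (cantor (beth_type m)).
apply: card_le_trans (card_le_trans _ _ _ h hm).
exact: (beth_le_omega (S m)).
Qed.

(** If [A] is not small, every [beth_type m] embeds in [A], hence so does their countable disjoint
    union, because [A * A] embeds in [A]. *)
Lemma lt_omega_small A : card_lt A beth_omega -> small A.
Proof.
move=> [_ n]; apply: NNPP => ns; apply: n.
have h m : card_le (beth_type m) A.
  case: (card_le_total (beth_type m) A) => // h; case: ns; by exists m.
apply: card_le_sigma => //; last exact: (h 0).
by apply: card_le_square; apply: (h 0).
Qed.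


(** * Complete ideals and coverings *)

(** Null sets closed under unions indexed by [I]. Properness is stated separately, as
    [~ N (fun _ => True)]. *)
Definition ideal (I : Type) {Y : Type} (N : (Y -> Prop) -> Prop) :=
  N (fun _ => False) /\
  (forall A B : Y -> Prop, (forall y, A y -> B y) -> N B -> N A) /\
  (forall F : I -> Y -> Prop, (forall i, N (F i)) -> N (fun y => exists i, F i y)).

(** By completeness, the pieces of a positive set cannot all be null. This is used to make a
    function [s] constant on a positive set. *)
Lemma positive_piece {I I' Y : Type} {N : (Y -> Prop) -> Prop} A (s : Y -> I') :
  ideal I N -> card_le I' I -> ~ N A -> exists i, ~ N (fun y => A y /\ s y = i).
Proof.
move=> [N0 [mono un]] [j hj] nA; apply: NNPP => n; apply: nA.
apply: (mono) (un (fun i y => exists i', j i' = i /\ A y /\ s y = i') _).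
  by move=> y Ay; exists (j (s y)), (s y).
move=> i; case: (classic (exists i', j i' = i)) => [[i' e]|ni].
  have h : N (fun y => A y /\ s y = i').
    by apply: NNPP => n'; apply: n; exists i'.
  apply: (mono) h => y [i2 [e2 h2]].
  by rewrite -e in e2; rewrite -(hj _ _ e2).
by apply: (mono) N0 => y [i' [e _]]; apply: ni; exists i'.
Qed.

Lemma ideal_or {Y : Type} {N : (Y -> Prop) -> Prop} (A B : Y -> Prop) :
  ideal nat N -> N A -> N B -> N (fun y => A y \/ B y).
Proof.
move=> [N0 [mono un]] hA hB.
apply: (mono) (un (fun k => if k is O then A else B) _).
  by move=> y [h|h]; [exists 0|exists 1].
by case.
Qed.

(** The family [P] may depend on [Y], but the number [n] may not. *)
Definition covers (n : nat) (X : Type) := forall Y, small Y ->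
  exists P : (X -> Prop) -> Prop,
  card_le {a | P a} (X + beth_omega) /\ (forall a, P a -> small {x | a x}) /\
  forall g : Y -> X, exists a : beth_type n -> X -> Prop,
    (forall i, P (a i)) /\ forall y, exists i, a i (g y).

Lemma covers_eq n X Z : card_eq X Z -> covers n X -> covers n Z.
Proof.
move=> [hXZ [j hj]] cov Y sY; have [P [cP [sP hP]]] := cov Y sY.
exists (fun b => exists u : {a | P a}, b = fun z => proj1_sig u (j z)).
split; [|split].
- apply: card_le_image; apply: card_le_trans cP _.
  by apply: card_le_sum => //; apply: card_le_refl.
- move=> b [[a pa] /= ->]; apply: small_le (sP a pa).
  exists (fun z => exist (fun x => a x) (j (proj1_sig z)) (proj2_sig z)) => x y [/hj].
  exact: sig_ext.
- move=> g; have [a [pa ha]] := hP (fun y => j (g y)).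
  exists (fun i z => a i (j z)); split=> // i.
  by exists (exist _ (a i) (pa i)).
Qed.

Lemma inf_sum X : card_le nat (X + beth_omega).
Proof.
apply: card_le_trans nat_le_omega _; by exists inr => x y [].
Qed.

Lemma small_le_sum X A : small A -> card_le A (X + beth_omega).
Proof.
move/small_le_omega => h; apply: card_le_trans h _; by exists inr => x y [].
Qed.

Lemma card_le_single M A (b : A) : card_le nat M -> card_le {a | a = b} M.
Proof.
move=> [i _]; exists (fun _ => i 0) => -[x ex] [y ey] _.
by apply: sig_ext; rewrite /= ex ey.
Qed.

Lemma card_le_image_set M A B (P : A -> Prop) (f : A -> B) :
  card_le {a | P a} M -> card_le {b | exists a, P a /\ b = f a} M.
Proof.
move=> h; apply: card_le_trans (card_le_image M _ _ (fun u => f (proj1_sig u)) h).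
by apply: card_le_sub => b [a [pa e]]; exists (exist _ a pa).
Qed.

(* If no cover of [g] existed, the sets coverable by [beth_n]
   members would form a proper ideal, and the member caught by that ideal
   would itself be coverable. *)
Lemma cover_of_catch n X Y : small Y ->
  (forall N : (Y -> Prop) -> Prop, ideal (beth_type n) N -> ~ N (fun _ => True) ->
    exists P : (X -> Prop) -> Prop,
      card_le {a | P a} (X + beth_omega) /\ (forall a, P a -> small {x | a x}) /\
      forall g : Y -> X, exists a, P a /\ ~ N (fun y => a (g y))) ->
  exists P : (X -> Prop) -> Prop,
  card_le {a | P a} (X + beth_omega) /\ (forall a, P a -> small {x | a x}) /\
  forall g : Y -> X, exists a : beth_type n -> X -> Prop,
    (forall i, P (a i)) /\ forall y, exists i, a i (g y).
Proof.
move=> sY H.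
have [PN hPN] : exists PN : ((Y -> Prop) -> Prop) -> (X -> Prop) -> Prop,
    forall N, card_le {a | PN N a} (X + beth_omega) /\
      (forall a, PN N a -> small {x | a x}) /\
      (ideal (beth_type n) N -> ~ N (fun _ => True) ->
        forall g : Y -> X, exists a, PN N a /\ ~ N (fun y => a (g y))).
  apply: (functional_choice (fun N P => card_le {a | P a} (X + beth_omega) /\
      (forall a, P a -> small {x | a x}) /\
      (ideal (beth_type n) N -> ~ N (fun _ => True) ->
        forall g : Y -> X, exists a, P a /\ ~ N (fun y => a (g y))))) => N.
  case: (classic (ideal (beth_type n) N /\ ~ N (fun _ => True))) => [[h1 h2]|h].
    have [P [h3 [h4 h5]]] := H N h1 h2; by exists P.
  exists (fun _ => False); split; [|split=> //].
    by apply: card_le_empty => -[[]].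
  by move=> h1 h2; case: h.
exists (fun a => a = (fun _ => False) \/ exists N, PN N a); split; [|split].
- apply: card_le_or; [exact: inf_sum|apply: card_le_single; exact: inf_sum|].
  apply: card_le_union; first by apply/card_le_square/inf_sum.
    by apply/small_le_sum/small_pow/small_pow.
  by move=> N; have [] := hPN N.
- move=> a [->|[N h]]; last by have [_ [h' _]] := hPN N; apply: h'.
  by exists 0; apply: card_le_empty => -[[]].
- move=> g; apply: NNPP => nc.
  set Q := fun a : X -> Prop => a = (fun _ => False) \/ exists N, PN N a.
  pose N A := exists a : beth_type n -> X -> Prop,
    (forall i, Q (a i)) /\ forall y, A y -> exists i, a i (g y).
  have idN : ideal (beth_type n) N.
    split; [|split].
    - by exists (fun _ _ => False); split=> // i; left.
    - move=> A B sAB [a [qa ha]]; exists a; split=> // y Ay; exact/ha/sAB.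
    - move=> F /functional_choice [a ha].
      have [b0 _] := nat_le_beth n.
      (* The [beth_n] covers, each with [beth_n] members, are reindexed into a single one. *)
      have [s hs] := card_le_surj _ _ (card_le_square _ (nat_le_beth n)) (b0 0, b0 0).
      exists (fun i => a (fst (s i)) (snd (s i))); split.
        by move=> i; have [h _] := ha (fst (s i)).
      move=> y [i Fy]; have [_ h] := ha i; have [j aj] := h y Fy.
      by have [k e] := hs (i, j); exists k; rewrite e.
  have pN : ~ N (fun _ => True).
    move=> [a [qa h]]; apply: nc; exists a; split=> // y; exact: h.
  have [_ [_ h]] := hPN N; have [a [pa na]] := h idN pN g.
  apply: na; exists (fun _ => a); split=> [_|y ay]; first by right; exists N.
  by have [b0 _] := nat_le_beth n; exists (b0 0).
Qed.

(** The members of a cover of the segment below [e] are read as subsets of [X] and given injective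
    codes [c] in [X + beth_omega]. Codes in [X] stay below [e], so that functions picking such codes
    remain under the bound [h] in [catch_exists]. *)
Lemma covers_below n X (ltX : X -> X -> Prop) e Y : small Y ->
  covers n (below ltX e) ->
  exists (P : (X -> Prop) -> Prop) (c : (X -> Prop) -> X + beth_omega),
  (forall a, P a -> small {x | a x}) /\
  (forall a b, P a -> P b -> c a = c b -> a = b) /\
  (forall a x, P a -> c a = inl x -> ltX x e) /\
  forall (g : Y -> X) (A : Y -> Prop), (forall y, A y -> ltX (g y) e) ->
    exists a : beth_type n -> X -> Prop,
      forall y, A y -> exists i, a i (g y) /\ P (a i).
Proof.
move=> sY cov; have [P [[c hc] [sP hP]]] := cov Y sY.
pose ext (b : below ltX e -> Prop) x := exists h : ltX x e, b (exist _ x h).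
have extE b u : ext b (proj1_sig u) <-> b u.
  split=> [[h bu]|bu]; first by rewrite (sig_ext _ _ u (exist _ (proj1_sig u) h)).
  exists (proj2_sig u); by rewrite -(sig_ext _ _ u (exist _ (proj1_sig u) (proj2_sig u))).
pose emb (u : below ltX e + beth_omega) : X + beth_omega :=
  match u with inl v => inl (proj1_sig v) | inr z => inr z end.
have embI u v : emb u = emb v -> u = v.
  by case: u v => [u|u] [v|v] //= [] => [/sig_ext ->|->].
have [c' hc'] : exists c' : (X -> Prop) -> X + beth_omega, forall a,
    (exists b, P b /\ a = ext b) ->
    exists b (pb : P b), a = ext b /\ c' a = emb (c (exist _ b pb)).
  apply: (functional_choice (fun a m => (exists b, P b /\ a = ext b) ->
    exists b (pb : P b), a = ext b /\ m = emb (c (exist _ b pb)))) => a.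
  case: (classic (exists b, P b /\ a = ext b)) => [[b [pb eb]]|nb].
    by exists (emb (c (exist _ b pb))) => _; exists b, pb.
  by exists (inr (existT beth_type 0 0)) => /nb.
exists (fun a => exists b, P b /\ a = ext b), c'; split; [|split; [|split]].
- move=> a [b [pb ->]]; apply: small_le (sP b pb).
  apply: (card_le_rel (R := fun x u => proj1_sig x = proj1_sig (proj1_sig u))).
    by move=> [x [h bx]]; exists (exist _ (exist _ x h) bx).
  by move=> x y u h h'; apply: sig_ext; rewrite h h'.
- move=> a a' /hc' [b [pb [-> ->]]] /hc' [b' [pb' [-> ->]]] /embI /hc [->] //.
- move=> a x /hc' [b [pb [_ ->]]]; case: (c _) => [u|//] /= [<-].
  exact: (proj2_sig u).
- move=> g A hA.
  case: (classic (exists y, A y)) => [[y0 Ay0]|nA]; last first.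
    by exists (fun _ _ => False) => y Ay; case: nA; exists y.
  have [g' hg'] : exists g' : Y -> below ltX e, forall y, A y -> proj1_sig (g' y) = g y.
    apply: (functional_choice (fun y u => A y -> proj1_sig u = g y)) => y.
    case: (classic (A y)) => [Ay|nAy]; first by exists (exist _ (g y) (hA y Ay)).
    by exists (exist _ (g y0) (hA y0 Ay0)).
  have [a [pa ha]] := hP g'.
  exists (fun i => ext (a i)) => y Ay; have [i hi] := ha y.
  exists i; split; last by exists (a i).
  by rewrite -hg' //; apply/extE.
Qed.

(** * Almost-everywhere distinct families *)

Section Rank.
Variables (X : Type) (ltX : X -> X -> Prop).
Hypothesis wX : strict_wellorder ltX.
Variables (M T : Type) (ltT : T -> T -> Prop).
Hypothesis wT : strict_wellorder ltT.
Hypothesis infM : card_le nat M.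
Hypothesis segT : forall i, card_le (below ltT i) M.
Hypothesis bigT : ~ card_le T M.

Lemma le_or_succ_le Z : card_le Z M \/ card_le T Z.
Proof.
have [_ [_ [tot wf]]] := wT.
case: (classic (exists i, card_le Z (below ltT i))) => [[i h]|n].
  by left; apply: card_le_trans h (segT i).
right; apply: (greedy_inj _ ltT) => // i h; apply: n; by exists i.
Qed.

(** [T] acts as the successor cardinal of [M]: a union of [M] classes of size at most [M] is too
    small to be [T]. *)
Lemma pigeon I (h : T -> I) : card_le I M -> exists i, card_le T {t | h t = i}.
Proof.
move=> hI; apply: NNPP => n; apply: bigT.
apply: (@card_le_trans _ {t | exists i, h t = i}).
  by exists (fun t => exist _ t (ex_intro _ (h t) eq_refl)) => x y [].
apply: card_le_union => //; first exact: card_le_square.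
move=> i; case: (le_or_succ_le {t | h t = i}) => // hT.
by case: n; exists i.
Qed.

Variables (Y : Type) (N : (Y -> Prop) -> Prop).
Hypothesis idN : ideal nat N.
Hypothesis properN : ~ N (fun _ => True).
Hypothesis powY : card_le (Y -> Prop) M.
Variable x0 : X.

(* [None] plays the role of the order type of [X] itself. *)
Definition lt_top (x : X) (o : option X) :=
  match o with Some z => ltX x z | None => True end.

(** A family of successor size over [M], almost everywhere distinct modulo [N]; only values on [B]
    matter. *)
Definition wide (B : Y -> Prop) (f : Y -> option X) :=
  exists phi : T -> Y -> X, (forall i y, B y -> lt_top (phi i y) (f y)) /\
    forall i j, i <> j -> N (fun y => B y /\ phi i y = phi j y).

Lemma wide_sub B B' f f' : (forall y, B' y -> B y) -> (forall y, B' y -> f' y = f y) ->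
  wide B f -> wide B' f'.
Proof.
have [_ [mono _]] := idN.
move=> sB ef [phi [hb hd]]; exists phi; split.
- by move=> i y By; rewrite ef //; apply: hb; apply: sB.
- move=> i j ij; apply: (mono) (hd i j ij) => y [By e]; split=> //; exact: sB.
Qed.

(** The family is built greedily along [T]. If the construction is stuck at [i], the at most [M]
    functions built so far form the set [W]. *)
Lemma wide_or_maximal B f : wide B f \/
  exists W : (Y -> X) -> Prop, card_le {w | W w} M /\
    forall g, (forall y, B y -> lt_top (g y) (f y)) ->
      exists w, W w /\ ~ N (fun y => B y /\ g y = w y).
Proof.
have [_ [mono _]] := idN; have [_ [_ [tot wf]]] := wT.
case: (classic (exists W : (Y -> X) -> Prop, card_le {w | W w} M /\
    forall g, (forall y, B y -> lt_top (g y) (f y)) ->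
      exists w, W w /\ ~ N (fun y => B y /\ g y = w y))) => [|n]; first by right.
left.
have [i h|phi hphi] := greedy T ltT (Y -> X) (fun i h g =>
  (forall y, B y -> lt_top (g y) (f y)) /\
  forall q, N (fun y => B y /\ g y = h q y)) wf.
  apply: NNPP => n'; apply: n; exists (fun w => exists q, w = h q); split.
    apply: card_le_image; exact: segT.
  move=> g hg; apply: NNPP => n2; apply: n'; exists g; split=> // q.
  apply: NNPP => n3; apply: n2; exists (h q); split=> //; by exists q.
exists phi; split=> [i|i j ij]; first by have [] := hphi i.
case: (tot i j) => [r|[//|r]].
- have [_ h] := hphi j; apply: (mono) (h (exist _ i r)) => y [By e]; by split.
- by have [_ h] := hphi i; apply: (mono) (h (exist _ j r)).
Qed.

(** Countably many pieces and a null remainder are allowed so that, for fixed [f], these sets form a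
    countably complete ideal containing [N]. *)
Definition reducible (f : Y -> option X) (A : Y -> Prop) :=
  exists (B : nat -> Y -> Prop) (h : nat -> Y -> X),
    N (fun y => A y /\ ~ exists k, B k y) /\
    forall k, (forall y, B k y -> lt_top (h k y) (f y)) /\
      wide (B k) (fun y => Some (h k y)).

Lemma reducible_null f A : N A -> reducible f A.
Proof.
have [N0 [mono _]] := idN.
move=> nA; exists (fun _ _ => False), (fun _ _ => x0); split.
  by apply: (mono) nA => y [].
move=> k; split=> //; exists (fun _ _ => x0); split=> // i j _.
by apply: (mono) N0 => y [].
Qed.

Lemma reducible_one f A h : (forall y, A y -> lt_top (h y) (f y)) ->
  wide A (fun y => Some (h y)) -> reducible f A.
Proof.
have [N0 [mono _]] := idN.
move=> hb hw; exists (fun _ => A), (fun _ => h); split=> //.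
by apply: (mono) N0 => y [Ay n]; apply: n; exists 0.
Qed.

Lemma reducible_ideal f : ideal nat (reducible f).
Proof.
have [N0 [mono un]] := idN; split; [exact: reducible_null|split].
- move=> A A' sA [B [h [nB hB]]]; exists B, h; split=> //.
  by apply: (mono) nB => y [/sA].
- move=> F hF.
  have [s hs] : exists s : nat -> (nat -> Y -> Prop) * (nat -> Y -> X), forall k,
      N (fun y => F k y /\ ~ exists l, fst (s k) l y) /\
      forall l, (forall y, fst (s k) l y -> lt_top (snd (s k) l y) (f y)) /\
        wide (fst (s k) l) (fun y => Some (snd (s k) l y)).
    apply: (functional_choice (fun k s => N (fun y => F k y /\ ~ exists l, fst s l y) /\
      forall l, (forall y, fst s l y -> lt_top (snd s l y) (f y)) /\
        wide (fst s l) (fun y => Some (snd s l y)))) => k.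
    by have [B [h hBh]] := hF k; exists (B, h).
  exists (fun m => fst (s (fst (of_nat m))) (snd (of_nat m))),
    (fun m => snd (s (fst (of_nat m))) (snd (of_nat m))); split; last first.
    by move=> m; have [_ h] := hs (fst (of_nat m)).
  apply: (mono) (un (fun k y => F k y /\ ~ exists l, fst (s k) l y) _).
    move=> y [[k Fy] n]; exists k; split=> // -[l hl]; apply: n.
    by exists (to_nat (k, l)); rewrite cancel_of_to.
  by move=> k; have [] := hs k.
Qed.

(* Otherwise every wide [f] could be lowered almost everywhere, gluing over
   countable partitions, and iterating would give an infinite descent. *)
Lemma irreducible_exists : wide (fun _ => True) (fun _ => None) ->
  exists B f, wide B f /\ ~ reducible f B.
Proof.
have [N0 [mono un]] := idN.
move=> w0; apply: NNPP => n.
have red B f : wide B f -> reducible f B.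
  by move=> w; apply: NNPP => n'; apply: n; exists B, f.
(* Lowering uses different functions on different pieces, so wideness can only be maintained
   piecewise. *)
pose lw f := exists B : nat -> Y -> Prop,
  N (fun y => ~ exists k, B k y) /\ forall k, wide (B k) f.
have step f : lw f -> exists h : Y -> X, lw (fun y => Some (h y)) /\
    N (fun y => ~ lt_top (h y) (f y)).
  move=> [B [nB wB]].
  have [_ [_ unJ]] := reducible_ideal f.
  have [C [h [nC hC]]] := unJ B (fun k => red _ _ (wB k)).
  have nC' : N (fun y => ~ exists k, C k y).
    apply: (mono) (ideal_or _ _ idN nB nC) => y nCy.
    by case: (classic (exists k, B k y)) => hy; [right|left].
  (* [idx] selects one piece at each point, which glues the functions [h k] into one. *)
  have [idx hidx] : exists idx : Y -> nat, forall y, (exists k, C k y) -> C (idx y) y.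
    apply: (functional_choice (fun y k => (exists k, C k y) -> C k y)) => y.
    case: (classic (exists k, C k y)) => [[k Cy]|nk]; first by exists k.
    by exists 0.
  exists (fun y => h (idx y) y); split.
    exists (fun k y => C k y /\ idx y = k); split.
      apply: (mono) nC' => y n1 [k Cy]; apply: n1; exists (idx y); split=> //.
      by apply: hidx; exists k.
    move=> k; have [_ wk] := hC k.
    by apply: wide_sub wk => y [] // _ ->.
  apply: (mono) nC' => y n1 ex; apply: n1.
  have [hb _] := hC (idx y); exact/hb/hidx.
have [h0 [lw0 _]] : exists h : Y -> X, lw (fun y => Some (h y)) /\
    N (fun y => ~ lt_top (h y) None).
  apply: (step (fun _ => None)); exists (fun _ _ => True); split=> //.
  by apply: (mono) N0 => y n1; apply: n1; exists 0.
have [st hst] : exists st : {h | lw (fun y => Some (h y))} -> {h | lw (fun y => Some (h y))},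
    forall h, N (fun y => ~ ltX (proj1_sig (st h) y) (proj1_sig h y)).
  apply: (functional_choice (fun h h' : {h | lw (fun y => Some (h y))} =>
    N (fun y => ~ ltX (proj1_sig h' y) (proj1_sig h y)))) => -[h lwh].
  by have [h' [lw' nh']] := step _ lwh; exists (exist _ h' lw').
pose s := fix s k := match k with O => exist _ h0 lw0 | S k => st (s k) end.
apply: properN.
(* Each comparison fails only on a null set, so at almost every [y] the values would descend
   forever; hence all of [Y] is null. *)
apply: (mono) (un (fun k y => ~ ltX (proj1_sig (s (S k)) y) (proj1_sig (s k) y)) _).
  move=> y _; apply: NNPP => nk.
  apply: (wf_no_descent _ ltX (fun k => proj1_sig (s k) y)).
    by have [_ [_ []]] := wX.
  move=> k; apply: NNPP => n1; apply: nk; by exists k.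
move=> k; exact: hst.
Qed.

(** [J] is the ideal [reducible f] for an irreducible [f], [h] is one member of a wide family below
    [f], and [phi] lists other members by [X]. The last clause holds because a wide family below [h]
    on [B] would lower [f] there. *)
Lemma configuration (rk : X -> nat) : card_le X M ->
  wide (fun _ => True) (fun _ => None) ->
  exists (J : (Y -> Prop) -> Prop) (C : Y -> Prop) (phi : X -> Y -> X) (h : Y -> X) (n : nat),
  ideal nat J /\ (forall A, N A -> J A) /\ (forall y, C y -> rk (h y) = n) /\
  (forall x x', x <> x' -> N (fun y => C y /\ phi x y = phi x' y)) /\
  (forall x, ~ J (fun y => C y /\ ltX (phi x y) (h y))) /\
  (forall B, (forall y, B y -> C y) -> ~ J B -> ~ wide B (fun y => Some (h y))).
Proof.
have [_ [_ [totX _]]] := wX.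
have [N0 [mono un]] := idN.
move=> leX w0; have [B [f [[phi0 [hb hd]] nJ]]] := irreducible_exists w0.
have idJ := reducible_ideal f; have [J0 [monoJ unJ]] := idJ.
have [nv hnv] : exists nv : T -> nat, forall i,
    ~ reducible f (fun y => B y /\ rk (phi0 i y) = nv i).
  apply: (functional_choice (fun i n => ~ reducible f (fun y => B y /\ rk (phi0 i y) = n))).
  move=> i; exact: (positive_piece B (fun y => rk (phi0 i y)) idJ (card_le_refl _) nJ).
(* There are at most [M] pairs of a rank and a subset of [Y], so [T] many members share both. *)
pose code i := (nv i, fun y => B y /\ rk (phi0 i y) = nv i).
have [[n C] [psi hpsi]] : exists i, card_le T {t | code t = i}.
  apply: pigeon; apply: card_le_trans _ (card_le_square _ infM).
  exact: card_le_prod.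
pose phi1 i := phi0 (proj1_sig (psi i)).
have hC i y : C y -> B y /\ rk (phi1 i y) = n.
  rewrite /phi1; case: (psi i) => t /= [<- <-] //.
have [i0] : inhabited T.
  by apply: NNPP => nT; apply/bigT/card_le_empty.
have nJC : ~ reducible f C.
  by case: (psi i0) => t e; move: (hnv t); case: e => _ <-.
have hd1 i j : i <> j -> N (fun y => C y /\ phi1 i y = phi1 j y).
  move=> ij; apply: (mono) (hd (proj1_sig (psi i)) (proj1_sig (psi j)) _).
    by move=> y [Cy e]; split=> //; have [] := hC i y Cy.
  by move=> /sig_ext /hpsi.
pose S i j := ~ reducible f (fun y => C y /\ ltX (phi1 j y) (phi1 i y)).
(* Otherwise [T] many indices [j] share the same positive set. There they form a wide family below
   [phi1 i], so that set is reducible. *)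
have fewS i : card_le {j | S i j} M.
  case: (le_or_succ_le {j | S i j}) => // -[j hj].
  have [B' [k hk]] := pigeon _
    (fun t y => C y /\ ltX (phi1 (proj1_sig (j t)) y) (phi1 i y)) powY.
  have [t et] : {t | (fun y => C y /\ ltX (phi1 (proj1_sig (j t)) y) (phi1 i y)) = B'}.
    exact: (k i0).
  case: (proj2_sig (j t)); rewrite et; apply: (reducible_one _ _ (phi1 i)).
    by rewrite -et => y [/(hC i) [By _] _]; apply: hb.
  exists (fun t => phi1 (proj1_sig (j (proj1_sig (k t))))); split.
    by move=> t' y; case: (k t') => u /= <- [].
  move=> t1 t2 t12.
  apply: (mono) (hd1 (proj1_sig (j (proj1_sig (k t1)))) (proj1_sig (j (proj1_sig (k t2)))) _).
    by move=> y [By e]; split=> //; move: By; rewrite -et => -[].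
  by move=> /sig_ext /hj /sig_ext /hk.
have [e he] : card_le X T.
  apply: card_le_trans leX _; case: (card_le_total M T) => // h.
(* The sets [S (e x)], each with [e x] added, have union of size at most [M], so some [i] escapes
   them. Then [phi1 (e x)] is below [phi1 i] on a [J]-positive set for every [x]. *)
have [i hi] : exists i, ~ exists x, S (e x) i \/ i = e x.
  apply: NNPP => ni; apply: bigT.
  apply: (@card_le_trans _ {i | exists x, S (e x) i \/ i = e x}).
    have hx i : exists x, S (e x) i \/ i = e x.
      by apply: NNPP => n'; apply: ni; exists i.
    by exists (fun i => exist _ i (hx i)) => x y [].
  apply: card_le_union => //; first exact: card_le_square.
  move=> x; apply: card_le_or => //; exact: card_le_single.
exists (reducible f), C, (fun x => phi1 (e x)), (phi1 i), n.
split=> //; split; [exact: reducible_null|split; [|split; [|split]]].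
- by move=> y /(hC i) [].
- by move=> x x' xx'; apply: hd1 => /he.
- move=> x Jx; apply: nJC.
  have h1 : reducible f (fun y => C y /\ ltX (phi1 i y) (phi1 (e x) y)).
    by apply: NNPP => n'; apply: hi; exists x; left.
  have h2 : reducible f (fun y => C y /\ phi1 i y = phi1 (e x) y).
    by apply/reducible_null/hd1 => ei; apply: hi; exists x; right.
  apply: (monoJ) (ideal_or _ _ idJ Jx (ideal_or _ _ idJ h1 h2)) => y Cy.
  case: (totX (phi1 (e x) y) (phi1 i y)) => [|[|]]; auto.
- move=> B' sB nJ' wB; apply: nJ'; apply: (reducible_one _ _ (phi1 i)) => // y By.
  by apply: hb; have [] := hC i y (sB y By).
Qed.
End Rank.


(** * From covers of the bounds [h y] to a cover of [X] *)

Section Catch.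
Variables (X : Type) (ltX : X -> X -> Prop).
Local Notation M := (X + beth_omega)%type.
Variables (Y : Type) (N J : (Y -> Prop) -> Prop).
Hypotheses (idN : ideal nat N) (idJ : ideal nat J) (NJ : forall A, N A -> J A).
Hypothesis smallY : small Y.
Variables (C : Y -> Prop) (phi : X -> Y -> X) (h : Y -> X) (n : nat).
Hypothesis cov : forall y, C y -> covers n (below ltX (h y)).
Hypothesis phi_ne : forall x x', x <> x' -> N (fun y => C y /\ phi x y = phi x' y).
Hypothesis phi_lt : forall x, ~ J (fun y => C y /\ ltX (phi x y) (h y)).
Hypothesis maxl : forall B, (forall y, B y -> C y) -> ~ J B ->
  exists W : (Y -> X) -> Prop, card_le {w | W w} M /\
    forall g, (forall y, B y -> ltX (g y) (h y)) ->
      exists w, W w /\ ~ N (fun y => B y /\ g y = w y).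

Variables (Z : Type) (L : (Z -> Prop) -> Prop) (n' : nat).
Hypotheses (smallZ : small Z) (idL : ideal (beth_type n') L)
  (properL : ~ L (fun _ => True)).
Hypotheses (powY : card_le (Y -> Prop) (beth_type n'))
  (funY : card_le (Y -> beth_type n) (beth_type n')).

Lemma nonempty_of_positive A : ~ L A -> exists z, A z.
Proof.
have [L0 [monoL _]] := idL => nA; apply: NNPP => ne; apply: nA.
by apply: (monoL) L0 => z Az; apply: ne; exists z.
Qed.

(** A point [x] is represented by the function [phi x]. The catching sets are boxes: at each [y] of
    a set [B], [phi x y] must lie in the cover member coded by [u y]. There are few boxes because
    [u] may be taken from a fixed small supply, and the relevant ones are small because the
    functions [phi x] are almost everywhere distinct. *)
Lemma catch_exists : exists P : (X -> Prop) -> Prop,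
  card_le {a | P a} M /\ (forall a, P a -> small {x | a x}) /\
  forall g : Z -> X, exists a, P a /\ ~ L (fun z => a (g z)).
Proof.
have [L0 [monoL unL]] := idL; have [N0 [mono un]] := idN.
have [J0 [monoJ unJ]] := idJ.
have infM := inf_sum X; have sqM := card_le_square _ infM.
have powM : card_le (Y -> Prop) M by apply/small_le_sum/small_pow.
case: (classic (inhabited X)) => [[x0]|nX]; last first.
  have [z _] := nonempty_of_positive _ properL.
  exists (fun _ => False); split; [by apply: card_le_empty => -[[]]|split=> // g].
  by case: nX; exists; exact: (g z).
have [i0] : inhabited (beth_type n) by have [b _] := nat_le_beth n; exists; exact: (b 0).
have [Pc hPc] : exists Pc : Y -> ((X -> Prop) -> Prop) * ((X -> Prop) -> M),
    forall y, C y ->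
  (forall a, fst (Pc y) a -> small {x | a x}) /\
  (forall a b, fst (Pc y) a -> fst (Pc y) b -> snd (Pc y) a = snd (Pc y) b -> a = b) /\
  (forall a x, fst (Pc y) a -> snd (Pc y) a = inl x -> ltX x (h y)) /\
  forall (g : Z -> X) (A : Z -> Prop), (forall z, A z -> ltX (g z) (h y)) ->
    exists a : beth_type n -> X -> Prop,
      forall z, A z -> exists i, a i (g z) /\ fst (Pc y) (a i).
  apply: (functional_choice (fun y p => C y -> (forall a, fst p a -> small {x | a x}) /\
    (forall a b, fst p a -> fst p b -> snd p a = snd p b -> a = b) /\
    (forall a x, fst p a -> snd p a = inl x -> ltX x (h y)) /\
    forall (g : Z -> X) (A : Z -> Prop), (forall z, A z -> ltX (g z) (h y)) ->
    exists a : beth_type n -> X -> Prop,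
      forall z, A z -> exists i, a i (g z) /\ fst p (a i))) => y.
  case: (classic (C y)) => [Cy|nC]; last first.
    by exists ((fun _ => False), (fun _ => inl x0)) => /nC.
  have [P [c hPc]] := covers_below n X ltX (h y) Z smallZ (cov y Cy).
  by exists (P, c).
have [W hW] : exists W : (Y -> Prop) -> (Y -> X) -> Prop, forall B,
    card_le {w | W B w} M /\ ((forall y, B y -> C y) -> ~ J B ->
    forall g, (forall y, B y -> ltX (g y) (h y)) ->
      exists w, W B w /\ ~ N (fun y => B y /\ g y = w y)).
  apply: (functional_choice (fun B (W : (Y -> X) -> Prop) =>
    card_le {w | W w} M /\ ((forall y, B y -> C y) -> ~ J B ->
    forall g, (forall y, B y -> ltX (g y) (h y)) ->
      exists w, W w /\ ~ N (fun y => B y /\ g y = w y)))) => B.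
  case: (classic ((forall y, B y -> C y) /\ ~ J B)) => [[h1 h2]|nB].
    by have [W [h3 h4]] := maxl B h1 h2; exists W.
  exists (fun _ => False); split; first by apply: card_le_empty => -[[]].
  by move=> h1 h2; case: nB.
(* The supply of code functions: members of the maximal families [W B], and functions into a single
   [beth_type k]. *)
pose U (u : Y -> M) := (exists B w, W B w /\ u = fun y => inl (w y)) \/
  (exists k (v : Y -> beth_type k), u = fun y => inr (existT _ k (v y))).
have cU : card_le {u | U u} M.
  apply: card_le_or => //.
    apply: card_le_union => // B; apply: card_le_image_set.
    by have [] := hW B.
  apply: card_le_union => // k; apply: card_le_image.
  by apply/small_le_sum/small_fun => //; exists k; apply: card_le_refl.
pose box (u : Y -> M) (B : Y -> Prop) (x : X) := forall y, B y ->
  exists b, fst (Pc y) b /\ snd (Pc y) b = u y /\ b (phi x y).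
exists (fun a => small {x | a x} /\
  exists p : {u | U u} * (Y -> Prop), a = box (proj1_sig (fst p)) (snd p)).
split; [|split; [by move=> a []|]].
  have := card_le_image M _ _
    (fun p : {u | U u} * (Y -> Prop) => box (proj1_sig (fst p)) (snd p)).
  move=> H; apply: card_le_trans (H _); first by apply: card_le_sub => a [].
  exact: card_le_trans (card_le_prod _ _ _ _ cU powM) sqM.
move=> g.
(* Completeness of [L] fixes the set of [y] at which [phi (g z) y] is below [h y]. *)
have [B nA1] := positive_piece _ (fun z y => C y /\ ltX (phi (g z) y) (h y))
  idL powY properL.
set A1 := (fun z => True /\ _) in nA1.
have BE z : A1 z -> forall y, B y -> C y /\ ltX (phi (g z) y) (h y).
  by move=> [_ <-].
have [z1 A1z] := nonempty_of_positive _ nA1.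
have nJB : ~ J B by case: A1z => _ <-; apply: phi_lt.
have BC y : B y -> C y by move=> /(BE z1 A1z) [].
have [av hav] : exists av : Y -> beth_type n -> X -> Prop, forall y, B y ->
    forall z, A1 z -> exists i, av y i (phi (g z) y) /\ fst (Pc y) (av y i).
  apply: (functional_choice (fun y (a : beth_type n -> X -> Prop) => B y ->
    forall z, A1 z -> exists i, a i (phi (g z) y) /\ fst (Pc y) (a i))) => y.
  case: (classic (B y)) => [By|nB]; last by exists (fun _ _ => False) => /nB.
  have [_ [_ [_ hy]]] := hPc y (BC y By).
  have [z /BE H|a ha] := hy (fun z => phi (g z) y) A1; last by exists a.
  by have [] := H y By.
have [iv hiv] : exists iv : Z * Y -> beth_type n, forall p, B (snd p) -> A1 (fst p) ->
    av (snd p) (iv p) (phi (g (fst p)) (snd p)) /\ fst (Pc (snd p)) (av (snd p) (iv p)).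
  apply: (functional_choice (fun p i => B (snd p) -> A1 (fst p) ->
    av (snd p) i (phi (g (fst p)) (snd p)) /\ fst (Pc (snd p)) (av (snd p) i))).
  move=> [z y] /=; case: (classic (B y /\ A1 z)) => [[By Az]|nBA].
    by have [i hi] := hav y By z Az; exists i.
  by exists i0 => By Az; case: nBA.
(* It also fixes the function giving the index of the cover member containing [phi (g z) y], so that
   one [w y] serves all [z] in a positive set. *)
have [t nA2] := positive_piece _ (fun z y => iv (z, y)) idL funY nA1.
set A2 := (fun z => A1 z /\ _) in nA2.
pose w y := av y (t y).
have hw z : A2 z -> forall y, B y -> w y (phi (g z) y) /\ fst (Pc y) (w y).
  by rewrite /w => -[Az <-] y By; apply: (hiv (z, y)).
have [z2 A2z] := nonempty_of_positive _ nA2.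
have wP y : B y -> fst (Pc y) (w y) by move=> /(hw z2 A2z) [].
(* The kind of the code is made constant: [None] for codes in [X], [Some k] for codes in
   [beth_type k]. *)
have [o nB1] := positive_piece B (fun y => match snd (Pc y) (w y) with
  | inl _ => None | inr s => Some (projT1 s) end) idJ
  (card_le_option _ (card_le_refl nat)) nJB.
set B1 := (fun y => B y /\ _) in nB1.
have B1B y : B1 y -> B y by case.
have [u [Uu [B2 [B2B [nB2 uE]]]]] : exists u, U u /\ exists B2 : Y -> Prop,
    (forall y, B2 y -> B y) /\ ~ N B2 /\ forall y, B2 y -> snd (Pc y) (w y) = u y.
  case: o @B1 nB1 B1B => [k|] B1 nB1 B1B.
    have [i1] : inhabited (beth_type k).
      by have [b _] := nat_le_beth k; exists; exact: (b 0).
    have [v hv] : exists v : Y -> beth_type k, forall y, B1 y ->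
        snd (Pc y) (w y) = inr (existT _ k (v y)).
      apply: (functional_choice (fun y c => B1 y ->
        snd (Pc y) (w y) = inr (existT _ k c))) => y.
      case: (classic (B1 y)) => [[By]|nBy]; last by exists i1 => /nBy.
      case: (snd (Pc y) (w y)) => [//|[k' c]] [e]; subst k'; by exists c.
    exists (fun y => inr (existT _ k (v y))); split; first by right; exists k, v.
    by exists B1; split=> //; split=> // /NJ.
  pose v y := match snd (Pc y) (w y) with inl x => x | inr _ => x0 end.
  have hv y : B1 y -> snd (Pc y) (w y) = inl (v y).
    by rewrite /v => -[By]; case: (snd (Pc y) (w y)) => // -[].
  (* The codes [v] stay below [h] on the [J]-positive set [B1], so by maximality they agree with
     some [w'] in [W B1] on an [N]-positive set. *)
  have [_ hWB] := hW B1.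
  have [|//|y B1y|w' [Ww nw]] := hWB _ _ v.
  - by move=> y /B1B /BC.
  - have [_ [_ [hl _]]] := hPc y (BC y (B1B y B1y)).
    by apply: (hl (w y)); [apply: wP; apply: B1B|apply: hv].
  exists (fun y => inl (w' y)); split; first by left; exists B1, w'.
  exists (fun y => B1 y /\ v y = w' y); split; first by move=> y [/B1B].
  by split=> // y [/hv -> ->].
have [mm hmm] : exists mm : Y -> nat, forall y, B y -> card_le {x | w y x} (beth_type (mm y)).
  apply: (functional_choice (fun y m => B y -> card_le {x | w y x} (beth_type m))) => y.
  case: (classic (B y)) => [By|nB]; last by exists 0 => /nB.
  have [hs _] := hPc y (BC y By).
  by have [m hm] := hs _ (wP y By); exists m.
(* Shrinking to [B3] bounds all the sets [w y] by one [beth_type m]. *)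
have [m nB3] := positive_piece B2 mm idN (card_le_refl _) nB2.
set B3 := (fun y => B2 y /\ _) in nB3.
have B3B y : B3 y -> B y by move=> [/B2B].
exists (box u B3); split; last first.
  move=> La; apply: nA2; apply: (monoL) La => z A2z' y B3y.
  exists (w y); have [h1 h2] := hw z A2z' y (B3B y B3y).
  split=> //; split=> //; apply: uE; by case: B3y.
split; last by exists (exist _ u Uu, B3).
have [kk hkk] : exists kk : Y -> X -> beth_type m, forall y, B3 y ->
    forall x x', w y x -> w y x' -> kk y x = kk y x' -> x = x'.
  have [i1] : inhabited (beth_type m).
    by have [b _] := nat_le_beth m; exists; exact: (b 0).
  apply: (functional_choice (fun y (k : X -> beth_type m) => B3 y ->
    forall x x', w y x -> w y x' -> k x = k x' -> x = x')) => y.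
  case: (classic (B3 y)) => [B3y|nB]; last by exists (fun _ => i1) => /nB.
  have [k hk] : card_le {x | w y x} (beth_type m).
    by have := hmm y (B3B y B3y); case: B3y => _ ->.
  have [k' hk'] : exists k' : X -> beth_type m, forall x (hx : w y x),
      k' x = k (exist _ x hx).
    apply: (functional_choice (fun x c => forall hx : w y x, c = k (exist _ x hx))) => x.
    case: (classic (w y x)) => [hx|nx]; last by exists i1.
    exists (k (exist _ x hx)) => hx'; congr k; exact: sig_ext.
  exists k' => _ x x' hx hx'; rewrite (hk' x hx) (hk' x' hx') => /hk e.
  exact: (f_equal (@proj1_sig _ _) e).
have wbox x y : box u B3 x -> B3 y -> w y (phi x y).
  move=> hx B3y; have [b [Pb [eb bx]]] := hx y B3y.
  have [_ [inj _]] := hPc y (BC y (B3B y B3y)).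
  rewrite (inj (w y) b) //; first by apply/wP/B3B.
  by rewrite eb; apply: uE; case: B3y.
apply: (small_le _ (Y -> beth_type m)); last first.
  by apply: small_fun => //; exists m; apply: card_le_refl.
(* Two points of the box with the same image would have [phi] equal on all of [B3], which is not
   [N]-null. *)
exists (fun x y => kk y (phi (proj1_sig x) y)) => -[x hx] [x' hx'] /= e.
apply: sig_ext => /=; apply: NNPP => xx'; apply: nB3.
apply: (mono) (phi_ne x x' xx') => y B3y; split; first exact/BC/B3B.
apply: (hkk y B3y); [exact: wbox|exact: wbox|].
exact: (equal_f e y).
Qed.
End Catch.

(** Failure of [n = 0] supplies [N] and the configuration, whose rank [n] bounds the covers below
    every [h y] with [y] in [C]. [catch_exists] then yields a cover with a larger constant. *)
Lemma covers_step X (ltX : X -> X -> Prop) : strict_wellorder ltX ->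
  (forall x, exists n, covers n (below ltX x)) -> exists n, covers n X.
Proof.
move=> wX /functional_choice [rk hrk].
case: (classic (inhabited X)) => [[x0]|nX]; last first.
  exists 0 => Y sY; exists (fun a => a = fun _ => False); split; [|split].
  - apply: card_le_single; exact: inf_sum.
  - move=> a ->; exists 0; by apply: card_le_empty => -[[]].
  - move=> g; exists (fun _ _ => False); split=> // y.
    by case: nX; exists; exact: (g y).
apply: NNPP => H.
have infM := inf_sum X; set M := (X + beth_omega)%type in infM.
have [Y [sY nY]] : exists Y, small Y /\ ~ exists P : (X -> Prop) -> Prop,
    card_le {a | P a} M /\ (forall a, P a -> small {x | a x}) /\
    forall g : Y -> X, exists a : beth_type 0 -> X -> Prop,
      (forall i, P (a i)) /\ forall y, exists i, a i (g y).
  apply: NNPP => n; apply: H; exists 0 => Y sY; apply: NNPP => n'; apply: n.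
  by exists Y.
have [N [idN [pN nN]]] : exists N : (Y -> Prop) -> Prop,
    ideal nat N /\ ~ N (fun _ => True) /\ ~ exists P : (X -> Prop) -> Prop,
      card_le {a | P a} M /\ (forall a, P a -> small {x | a x}) /\
      forall g : Y -> X, exists a, P a /\ ~ N (fun y => a (g y)).
  apply: NNPP => n; apply: nY; apply: cover_of_catch => // N idN pN.
  by apply: NNPP => n'; apply: n; exists N.
have [N0 [mono un]] := idN.
have [T [ltT [wT [segT bigT]]]] := successor_card M.
have dich := wide_or_maximal X ltX M T ltT wT segT Y N idN.
(* Otherwise the ranges of a maximal family [W] would catch every [g], contrary to the choice of
   [N]. *)
have w0 : wide X ltX T Y N (fun _ => True) (fun _ => None).
  case: (dich (fun _ => True) (fun _ => None)) => // -[W [cW hW]]; case: nN.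
  exists (fun a => exists w, W w /\ a = fun x => exists y, x = w y).
  split; [exact: card_le_image_set|split].
  - move=> a [w [_ ->]]; apply: (small_le _ Y) => //.
    by apply: card_le_image; apply: card_le_refl.
  - move=> g; have [//|w [Ww nw]] := hW g.
    exists (fun x => exists y, x = w y); split; first by exists w.
    move=> na; apply: nw; apply: (mono) na => y [_ e]; by exists y.
have leX : card_le X M by exists inl => x y [].
have powY : card_le (Y -> Prop) M by apply/small_le_sum/small_pow.
have [J [C [phi [h [n [idJ [NJ [hn [ne [hlt hmax]]]]]]]]]] :=
  configuration X ltX wX M T ltT wT infM segT bigT Y N idN pN powY x0 rk leX w0.
have [m hm] := small_pow _ sY.
have [m' hm'] : small (Y -> beth_type n).
  by apply: small_fun => //; exists n; apply: card_le_refl.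
(* The constant bounds the subsets of [Y] and the functions [Y -> beth_type n], the two numbers of
   pieces met in [catch_exists]; it does not depend on [Z]. *)
apply: H; exists (max m m') => Z sZ; apply: cover_of_catch => // L idL pL.
apply: (catch_exists X ltX Y N J idN idJ NJ sY C phi h n _ ne hlt _ Z L (max m m')) => //.
- by move=> y Cy; rewrite -(hn y Cy); apply: hrk.
- move=> B BC nJ; case: (dich B (fun y => Some (h y))) => [w|//].
  by case: (hmax B BC nJ).
- by apply: card_le_trans hm _; apply: card_le_beth; lia.
- by apply: card_le_trans hm' _; apply: card_le_beth; lia.
Qed.

Lemma covers_segment X (ltX : X -> X -> Prop) : strict_wellorder ltX ->
  forall x, exists n, covers n (below ltX x).
Proof.
move=> wX x; elim/(well_founded_ind (proj2 (proj2 (proj2 wX)))): x => x IH.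
apply: (covers_step _ _ (below_wellorder _ _ _ wX)) => u.
have [n hn] := IH _ (proj2_sig u); exists n.
by apply: covers_eq hn; have [] := card_below_below _ _ _ u wX.
Qed.


(** * Regular cardinals *)

Section Regular.
Variables (T : Type) (lt : T -> T -> Prop).
Hypothesis reg : regular_cardinal lt.

Lemma reg_wellorder : strict_wellorder lt.
Proof. by have [[]] := reg. Qed.

Let irr : forall x, ~ lt x x := proj1 reg_wellorder.
Let trans : forall x y z, lt x y -> lt y z -> lt x z := proj1 (proj2 reg_wellorder).
Let tot : forall x y, lt x y \/ x = y \/ lt y x := proj1 (proj2 (proj2 reg_wellorder)).
Let wf : well_founded lt := proj2 (proj2 (proj2 reg_wellorder)).

Lemma le_lt_trans x y z : le lt x y -> lt y z -> lt x z.
Proof. by case=> [h|->] //; apply: trans. Qed.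

Lemma lt_le_trans x y z : lt x y -> le lt y z -> lt x z.
Proof. by move=> h [h'|<-] //; apply: trans h'. Qed.

Lemma lt_of_not_le x y : ~ le lt x y -> lt y x.
Proof. by move=> n; case: (tot x y) => [h|[h|//]]; case: n; [left|right]. Qed.

Lemma max_exists x y : exists z, le lt x z /\ le lt y z /\ (z = x \/ z = y).
Proof.
case: (tot x y) => [h|[->|h]].
- by exists y; split; [left|split; right].
- by exists y; split; [right|split; right].
- by exists x; split; [right|split; left].
Qed.

Lemma not_le_below d : ~ card_le T (below lt d).
Proof. by have [[_ /(_ d) []]] := reg. Qed.

Lemma reg_bounded (X : T -> Prop) : ~ card_le T {x | X x} ->
  exists b, forall x, X x -> lt x b.
Proof.
move=> few; have [_ [_ unb]] := reg.
apply: NNPP => n; apply: few; apply: unb => b; apply: NNPP => n'.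
apply: n; exists b => x Xx; apply: lt_of_not_le => h; apply: n'; by exists x.
Qed.

Lemma not_le_nat_single (A : Type) (b : A) : ~ card_le nat {a | a = b}.
Proof.
move=> [f hf]; have : 0 = 1 by apply: hf; apply: sig_ext; rewrite !(proj2_sig (f _)).
by [].
Qed.

Lemma reg_no_max b : exists c, lt b c.
Proof.
have [_ [inf _]] := reg.
have [c hc] : exists c, forall x, x = b -> lt x c; last by exists c; apply: hc.
by apply: reg_bounded => /(card_le_trans _ _ _ inf); apply: not_le_nat_single.
Qed.

(** If all classes were small, each would be bounded, and so would be the set of their bounds. *)
Lemma reg_pigeon I (h : T -> I) : ~ card_le T I -> exists i, card_le T {t | h t = i}.
Proof.
move=> few; apply: NNPP => n.
have /functional_choice [b hb] : forall i, exists b, forall t, h t = i -> lt t b.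
  by move=> i; apply: reg_bounded => H; apply: n; exists i.
have [c hc] : exists c, forall x, (exists i, x = b i) -> lt x c.
  apply: reg_bounded => H; apply: few; apply: card_le_trans H _.
  by apply: card_le_image; apply: card_le_refl.
apply: (irr c); apply: trans (hb (h c) c eq_refl) _; apply: hc; by exists (h c).
Qed.

Lemma reg_sigma I (F : I -> Type) : ~ card_le T I -> (forall i, ~ card_le T (F i)) ->
  ~ card_le T {i & F i}.
Proof.
move=> nI nF [j hj].
have [i hi] := reg_pigeon _ (fun t => projT1 (j t)) nI.
apply: (nF i); apply: card_le_trans hi _.
apply: (card_le_rel (R := fun u x => j (proj1_sig u) = existT _ i x)).
  by move=> [t /= e]; subst i; exists (projT2 (j t)); case: (j t).
by move=> u v x e e'; apply: sig_ext; apply: hj; rewrite e e'.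
Qed.

Lemma reg_sum A B : ~ card_le T A -> ~ card_le T B -> ~ card_le T (A + B).
Proof.
move=> nA nB h; have [_ [inf _]] := reg.
apply: (reg_sigma bool (fun b => if b then A else B)) => [hb||].
- have [f hf] := card_le_trans _ _ _ inf hb.
  have : f 0 = f 1 \/ f 0 = f 2 \/ f 1 = f 2.
    by case: (f 0) (f 1) (f 2) => [] [] []; auto.
  by case=> [/hf|[/hf|/hf]].
- by case.
- apply: card_le_trans h _.
  exists (fun u => match u with
    | inl a => existT (fun b : bool => if b then A else B) true a
    | inr b => existT _ false b end).
  by move=> [a|a] [b|b] // e; rewrite (inj_pair2_eq_dec _ Bool.bool_dec _ _ _ _ e).
Qed.

Lemma large_unbounded (A : T -> Prop) : card_le T {x | A x} ->
  forall b, exists x, A x /\ lt b x.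
Proof.
move=> h b; apply: NNPP => n; have [c bc] := reg_no_max b.
apply: (not_le_below c); apply: card_le_trans h _; apply: card_le_sub => x Ax.
apply: (le_lt_trans _ b) => //; case: (tot x b) => [r|[r|r]]; [by left|by right|].
by case: n; exists x.
Qed.

Lemma sup_exists (X : T -> Prop) b : (forall x, X x -> lt x b) ->
  exists s, (forall x, X x -> le lt x s) /\ forall c, lt c s -> exists x, X x /\ lt c x.
Proof.
move=> hb.
have [|s [us ms]] := wf_min _ lt (fun s => forall x, X x -> le lt x s) wf.
  by exists b => x /hb; left.
exists s; split=> // c cs; apply: NNPP => n; apply: (ms c cs) => x Xx.
case: (tot x c) => [r|[r|r]]; [by left|by right|].
by case: n; exists x.
Qed.

(** Recursion along [I]: before each new value in [C], a point of [A] is inserted above all earlier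
    values. Regularity bounds the sequence, and its supremum [s] is a limit of both sets. *)
Lemma limit_sequence I (ltI : I -> I -> Prop) (A C : T -> Prop) b0 :
  strict_wellorder ltI -> (forall i, exists j, ltI i j) -> ~ card_le T I -> inhabited I ->
  (forall b, exists x, A x /\ lt b x) -> unbounded lt C ->
  exists (v : I -> T) (s : T), (forall i, C (v i)) /\
    (forall i j, ltI i j -> lt (v i) (v j)) /\ (forall i, lt (v i) s) /\
    (forall c, lt c s -> exists i, lt c (v i)) /\ lt b0 s /\
    (forall c, lt c s -> exists x, A x /\ lt c x /\ lt x s).
Proof.
move=> [_ [_ [_ wfI]]] nomax few [i0] hA hC.
have [i h|v hv] := greedy I ltI T (fun i h t =>
  C t /\ lt b0 t /\ exists x, A x /\ (forall q, lt (h q) x) /\ lt x t) wfI.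
  have [b hb] : exists b, forall x, (exists q, x = h q) -> lt x b.
    apply: reg_bounded => H; apply: few; apply: card_le_trans H _.
    by apply: card_le_image; apply: card_le_proj1.
  have [b' [bb' [b0b' _]]] := max_exists b b0.
  have [x [Ax b'x]] := hA b'; have [c xc] := reg_no_max x.
  have [t [Ct ct]] := hC c; have xt := lt_le_trans _ _ _ xc ct.
  exists t; split=> //; split; first exact: trans (le_lt_trans _ _ _ b0b' b'x) xt.
  exists x; split=> //; split=> // q.
  apply: trans (le_lt_trans _ _ _ bb' b'x); apply: hb; by exists q.
have inc i j : ltI i j -> lt (v i) (v j).
  move=> ij; have [_ [_ [x [_ [hx xv]]]]] := hv j.
  exact: trans (hx (exist _ i ij)) xv.
have [b hb] : exists b, forall x, (exists i, x = v i) -> lt x b.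
  apply: reg_bounded => H; apply: few; apply: card_le_trans H _.
  by apply: card_le_image; apply: card_le_refl.
have [s [us ls]] := sup_exists _ _ hb.
have vs i : lt (v i) s.
  by have [j ij] := nomax i; apply: lt_le_trans (inc _ _ ij) _; apply: us; exists j.
have ls' c : lt c s -> exists i, lt c (v i) by move=> /ls [x [[i ->] r]]; exists i.
exists v, s; split; [by move=> i; have [] := hv i|split=> //; split=> //; split=> //].
split; first by have [_ [h _]] := hv i0; apply: trans h (vs i0).
move=> c /ls' [i ci]; have [j ij] := nomax i.
have [_ [_ [x [Ax [hx xv]]]]] := hv j; exists x; split=> //; split.
  exact: trans ci (hx (exist _ i ij)).
exact: trans xv (vs j).
Qed.

Lemma limit_points_club (A : T -> Prop) : ~ card_le T nat -> card_le T {x | A x} ->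
  club lt (fun d => forall b, lt b d -> exists x, A x /\ lt b x /\ lt x d).
Proof.
move=> few hA; split.
- move=> b.
  have wo : strict_wellorder Peano.lt.
    split; [lia|split; [lia|split; [lia|exact: Wf_nat.lt_wf]]].
  have [| | |v [s [_ [_ [_ [_ [bs hs]]]]]]] :=
    limit_sequence nat Peano.lt A (fun _ => True) b wo _ few (inhabits 0).
  + by move=> i; exists (S i).
  + exact: large_unbounded.
  + by move=> c; exists c; split=> //; right.
  by exists s; split=> //; left.
- move=> d _ hd b bd; have [g [hg [bg gd]]] := hd b bd.
  have [x [Ax [bx xg]]] := hg b bg; exists x; split=> //; split=> //.
  exact: trans xg gd.
Qed.
End Regular.

(** * Points of cofinality [K] *)

Section Cofinality.
Variables (T : Type) (lt : T -> T -> Prop) (K : Type) (ltK : K -> K -> Prop).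
Hypotheses (reg : regular_cardinal lt) (regK : regular_cardinal ltK).

(** For the lower bound, fewer than [K] points below [s] are dominated by values of [v] at indices
    bounded in [K], by regularity, so they are not cofinal. *)
Lemma cof_limit (v : K -> T) (s : T) :
  (forall i j, ltK i j -> lt (v i) (v j)) -> (forall i, lt (v i) s) ->
  (forall c, lt c s -> exists i, lt c (v i)) -> S_cof lt K s.
Proof.
have [irr [_ [_ _]]] := reg_wellorder _ _ reg.
have [_ [_ [totK _]]] := reg_wellorder _ _ regK.
move=> inc vs hs; split.
- exists (fun x => exists k, x = v k); split; [split|split].
  + by move=> x [k ->].
  + move=> b /hs [k bk]; exists (v k); split; [by exists k|by left].
  + by apply: card_le_image; apply: card_le_refl.
  + exists (fun k => exist (fun x => exists k, x = v k) (v k) (ex_intro _ k eq_refl)).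
    move=> k k' [e]; case: (totK k k') => [/inc|[//|/inc]]; rewrite e => /irr //.
- move=> Y [Ys cY]; apply: NNPP => n.
  have [kf hkf] : exists kf : {y | Y y} -> K, forall y, lt (proj1_sig y) (v (kf y)).
    apply: (functional_choice (fun y k => lt (proj1_sig y) (v k))) => y.
    by apply: hs; apply: Ys; exact: (proj2_sig y).
  have [k0 hk0] : exists k0, forall k, (exists y, k = kf y) -> ltK k k0.
    apply: (reg_bounded _ _ regK) => H; apply: n; apply: card_le_trans H _.
    by apply: card_le_image; apply: card_le_refl.
  have [y [Yy ky]] := cY _ (vs k0).
  apply: (irr (v k0)); apply: (le_lt_trans _ _ reg) ky _.
  have [_ [tr _]] := reg_wellorder _ _ reg.
  apply: tr (hkf (exist _ y Yy)) _; apply: inc; apply: hk0; by exists (exist _ y Yy).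
Qed.

(** The sequence is increasing and at index [io x] exceeds the point [x] of a fixed cofinal set.
    Hence every set of indices of full size, being unbounded in [K], gives cofinal values. *)
Lemma cofinal_sequence (A : T -> Prop) d : S_cof lt K d ->
  (forall b, lt b d -> exists x, A x /\ lt b x /\ lt x d) ->
  exists u : K -> T, (forall k, A (u k) /\ lt (u k) d) /\
    forall V : K -> Prop, card_le K {k | V k} ->
      forall b, lt b d -> exists k, V k /\ lt b (u k).
Proof.
move=> [[X [[Xd cX] [[io hio] _]]] mn] hA.
have [_ [tr _]] := reg_wellorder _ _ reg.
have [_ [_ [_ wfK]]] := reg_wellorder _ _ regK.
have [k h|u hu] := greedy K ltK {x | A x /\ lt x d} (fun k h t =>
  (forall q, lt (proj1_sig (h q)) (proj1_sig t)) /\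
  forall x : {x | X x}, io x = k -> lt (proj1_sig x) (proj1_sig t)) wfK.
  (* The earlier values are fewer than [K], hence not cofinal in [d]. *)
  have [b [bd hb]] : exists b, lt b d /\ forall q, lt (proj1_sig (h q)) b.
    apply: NNPP => n; apply: (not_le_below _ _ regK k).
    apply: (@card_le_trans _ {x | exists q, x = proj1_sig (h q)}); last first.
      by apply: card_le_image; apply: card_le_refl.
    apply: mn; split; first by move=> x [q ->]; have [] := proj2_sig (h q).
    move=> b bd; apply: NNPP => n'; apply: n; exists b; split=> // q.
    apply: (lt_of_not_le _ _ reg) => le_b; apply: n'.
    by exists (proj1_sig (h q)); split=> //; exists q.
  have [b' [b'd [bb' hx]]] : exists b', lt b' d /\ le lt b b' /\
      forall x : {x | X x}, io x = k -> le lt (proj1_sig x) b'.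
    case: (classic (exists x, io x = k)) => [[x ex]|nx]; last first.
      by exists b; split=> //; split=> [|x ex]; [right|case: nx; exists x].
    have [b' [h1 [h2 h3]]] := max_exists _ _ reg b (proj1_sig x).
    exists b'; split; first by case: h3 => -> //; apply: Xd; exact: (proj2_sig x).
    by split=> // x'; rewrite -ex => /hio ->.
  have [t [At [b't td]]] := hA b' b'd.
  exists (exist _ t (conj At td)); split=> [q|x ex] /=.
    exact: tr (hb q) (le_lt_trans _ _ reg _ _ _ bb' b't).
  exact: (le_lt_trans _ _ reg _ _ _ (hx x ex) b't).
exists (fun k => proj1_sig (u k)); split; first by move=> k; exact: (proj2_sig (u k)).
move=> V hV b bd; have [x [Xx bx]] := cX b bd.
have [k [Vk xk]] := large_unbounded _ _ regK V hV (io (exist _ x Xx)).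
exists k; split=> //.
have [h1 _] := hu k; have [_ h2] := hu (io (exist _ x Xx)).
apply: tr (h1 (exist _ _ xk)); apply: (le_lt_trans _ _ reg) bx _.
exact: (h2 (exist _ x Xx)).
Qed.
End Cofinality.

(** * The guessing families *)

Section Guessing.
Variables (T : Type) (lt : T -> T -> Prop).
Hypotheses (reg : regular_cardinal lt) (big : card_lt beth_omega T).

Lemma small_few A : small A -> ~ card_le T A.
Proof.
by move=> /small_le_omega h h'; case: big => _; apply; apply: card_le_trans h' h.
Qed.

(** Each segment has its own constant; as [T] is regular and uncountable, one constant recurs
    unboundedly often. *)
Lemma uniform_covers : exists n, forall d, exists d', lt d d' /\ covers n (below lt d').
Proof.
have [rk hrk] := functional_choice _ (covers_segment T lt (reg_wellorder _ _ reg)).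
have [|n hn] := reg_pigeon _ _ reg nat rk.
  by apply: small_few; exists 0; apply: card_le_refl.
exists n => d; have [d' [e dd']] := large_unbounded _ _ reg _ hn d.
by exists d'; split=> //; rewrite -e.
Qed.

(** [P] consists of the subsets of [d] of size at most [K] included in some member of a cover of the
    segment below [d']. The cover has fewer than [T] members, each with a small number of subsets.
    The point [d'] above [d] appears because a cover with the given [n] is available only cofinally
    often. *)
Lemma family_exists n K d d' : small K -> lt d d' -> covers n (below lt d') ->
  exists P : (T -> Prop) -> Prop, good_family lt P d K /\
    forall u : K -> T, (forall k, lt (u k) d) ->
      exists a : beth_type n -> T -> Prop, (forall k, exists i, a i (u k)) /\
        forall i X, (forall x, X x -> a i x /\ lt x d) -> card_le {x | X x} K -> P X.
Proof.
move=> sK dd' cov; have [Q [cQ [sQ hQ]]] := cov K sK.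
have [_ [tr _]] := reg_wellorder _ _ reg.
pose ext (b : below lt d' -> Prop) x := exists h : lt x d', b (exist _ x h).
exists (fun X => small_subset_of lt X d K /\ exists b, Q b /\ forall x, X x -> ext b x).
split; [split; [|by move=> X []]|].
- apply: card_lt_of_not_le => H.
  apply: (reg_sigma _ _ reg {b | Q b} (fun b => {X | forall x, X x -> ext (proj1_sig b) x})).
  + move=> H'; have := card_le_trans _ _ _ H' cQ; apply: (reg_sum _ _ reg).
      exact: (not_le_below _ _ reg).
    by have [] := big.
  + move=> -[b Qb] /=; apply: small_few.
    apply: small_le _ (small_pow _ (sQ b Qb)).
    exists (fun X x => proj1_sig X (proj1_sig (proj1_sig x))) => -[X hX] [X' hX'] /= e.
    apply: sig_ext => /=; apply: set_ext => x; split=> h.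
    * have [l bl] := hX x h; by rewrite -(equal_f e (exist _ (exist _ x l) bl)).
    * have [l bl] := hX' x h; by rewrite (equal_f e (exist _ (exist _ x l) bl)).
  + apply: card_le_trans H _.
    apply: (card_le_rel (R := fun X u => proj1_sig X = proj1_sig (projT2 u))).
      move=> [X [sX [b [Qb hX]]]].
      by exists (existT (fun b : {b | Q b} => {X | forall x, X x -> ext (proj1_sig b) x})
        (exist _ b Qb) (exist _ X hX)).
    by move=> X X' u e e'; apply: sig_ext; rewrite e e'.
- move=> u hu.
  have [a [Qa ha]] := hQ (fun k => exist _ (u k) (tr _ _ _ (hu k) dd')).
  exists (fun i => ext (a i)); split.
    by move=> k; have [i hi] := ha k; exists i, (tr _ _ _ (hu k) dd').
  move=> i X hX cX; split.
    by split=> // x /hX [].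
  by exists (a i); split=> // x /hX [].
Qed.

(** [K] exceeds [beth_type n] by Cantor's theorem, so one of the covering sets contains [u k] for
    [K] many [k], and these values are cofinal in [d]. *)
Lemma guess n K (ltK : K -> K -> Prop) d A (P : (T -> Prop) -> Prop) :
  regular_cardinal ltK -> card_le (beth_type (S n)) K -> S_cof lt K d ->
  (forall b, lt b d -> exists x, A x /\ lt b x /\ lt x d) ->
  (forall u : K -> T, (forall k, lt (u k) d) ->
      exists a : beth_type n -> T -> Prop, (forall k, exists i, a i (u k)) /\
        forall i X, (forall x, X x -> a i x /\ lt x d) -> card_le {x | X x} K -> P X) ->
  exists X, P X /\ subset X A /\ sup_eq lt X d.
Proof.
move=> regK leK cofd hA hP.
have [u [hu uV]] := cofinal_sequence _ _ _ _ reg regK A d cofd hA.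
have [k|a [/functional_choice [iv hiv] ha]] := hP u; first by have [] := hu k.
have [i hi] : exists i, card_le K {k | iv k = i}.
  apply: (reg_pigeon _ _ regK) => H; apply: (cantor (beth_type n)).
  exact: card_le_trans leK H.
exists (fun x => exists k, x = u k /\ iv k = i); split; [|split; [|split]].
- apply: (ha i) => [x [k [-> <-]]|]; first by split=> //; have [] := hu k.
  apply: card_le_trans (card_le_image K K T u (card_le_refl K)).
  by apply: card_le_sub => x [k [-> _]]; exists k.
- by move=> x [k [-> _]]; have [] := hu k.
- by move=> x [k [-> _]]; left; have [] := hu k.
- move=> b bd; have [k [e bk]] := uV _ hi b bd.
  by exists (u k); split=> //; exists k.
Qed.

(** The limit of a sequence of length [K] in [C], interleaved with [A], is the required point. *)
Lemma cof_stationary K (ltK : K -> K -> Prop) (A C : T -> Prop) :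
  regular_cardinal ltK -> small K -> card_le T {x | A x} -> club lt C ->
  exists d, C d /\ S_cof lt K d /\ forall b, lt b d -> exists x, A x /\ lt b x /\ lt x d.
Proof.
move=> regK sK hA [uC cC].
have [k0] : inhabited K by have [_ [[f _] _]] := regK; exists; exact: (f 0).
have [b0] : inhabited T by have [_ [[f _] _]] := reg; exists; exact: (f 0).
have [|v [s [Cv [inc [vs [hs [_ lim]]]]]]] := limit_sequence _ _ reg K ltK A C b0
  (reg_wellorder _ _ regK) (reg_no_max _ _ regK) (small_few _ sK) (inhabits k0) _ uC.
  exact: (large_unbounded _ _ reg).
exists s; split; [|split=> //].
- apply: cC; first by exists (v k0).
  by move=> b /hs [k bk]; exists (v k).
- exact: (cof_limit _ _ _ _ reg regK v s inc vs hs).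
Qed.
End Guessing.

(** * Exponents *)

(* If [Th ^ K'] is large for some small [K'], then every [K >= 2 ^ K'] violates the
   hypothesis on [exp_lt], since [Th ^ K'] is bounded by [exp_lt Th ltK]. *)
Lemma power_bound T : exists K1, small K1 /\
  forall (K : Type) (ltK : K -> K -> Prop), regular_cardinal ltK -> small K ->
  card_le K1 K -> (forall Th : Type, card_lt Th T -> card_lt (exp_lt Th ltK) T) ->
  forall Th : Type, card_lt Th T -> card_lt (K -> Th) T.
Proof.
case: (classic (exists K : Type, card_le nat K /\ small K /\
  exists Th : Type, card_lt Th T /\ ~ card_lt (K -> Th) T)) => [|n]; last first.
  exists unit; split; first by exists 0; exists (fun _ => 0) => -[] [].
  move=> K ltK [_ [inf _]] sK _ _ Th hTh; apply: NNPP => n'; apply: n.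
  by exists K; split=> //; split=> //; exists Th.
move=> [K' [[f _] [sK' [Th' [hTh' nTh']]]]].
exists (K' -> Prop); split; first exact: small_pow.
move=> K ltK regK sK leK H; case: nTh'; apply: card_lt_of_not_le => bad.
have [_] := H Th' hTh'; apply; apply: card_le_trans bad _.
(* Otherwise [K] would inject into [K'], although it is at least as large as the power set of
   [K']. *)
have [a ha] : exists a, card_le K' (below ltK a).
  have [_ [_ [totK wfK]]] := reg_wellorder _ _ regK.
  apply: NNPP => n; apply: (cantor K'); apply: card_le_trans leK _.
  apply: (greedy_inj _ ltK) => // a h; apply: n; by exists a.
have [r hr] := card_le_surj _ _ ha (f 0).
exists (fun p => existT (fun a => below ltK a -> Th') a (fun q => p (r q))) => p p' e.
have e' : (fun q => p (r q)) = (fun q => p' (r q)) by exact: (inj_pair2 _ _ _ _ _ e).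
apply: functional_extensionality => x; have [q <-] := hr x.
exact: (equal_f e' q).
Qed.

Lemma small_subsets_few T (lt : T -> T -> Prop) d K : regular_cardinal lt ->
  card_lt (K -> below lt d) T -> card_lt {X | small_subset_of lt X d K} T.
Proof.
move=> reg [_ nT]; have [_ [inf _]] := reg; apply: card_lt_of_not_le => H.
(* A nonempty subset is the range of a function on [K]; the extra point stands for the empty set. *)
apply: (reg_sum _ _ reg (K -> below lt d) {u : unit | u = tt}) => //.
  by move=> /(card_le_trans _ _ _ inf); apply: not_le_nat_single.
apply: card_le_trans H _.
apply: (card_le_rel (R := fun X o => match o with
  | inr _ => forall x, ~ proj1_sig X x
  | inl s => forall x, proj1_sig X x <-> exists k, proj1_sig (s k) = x end)).
- move=> [X [Xd cX]] /=.
  case: (classic (exists x, X x)) => [[x Xx]|nX]; last first.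
    by exists (inr (exist (fun u => u = tt) tt eq_refl)) => x Xx; apply: nX; exists x.
  have [s hs] := card_le_surj _ _ cX (exist _ x Xx).
  exists (inl (fun k => exist _ (proj1_sig (s k)) (Xd _ (proj2_sig (s k))))).
  move=> z /=; split=> [Xz|[k <-]]; last exact: (proj2_sig (s k)).
  by have [k e] := hs (exist _ z Xz); exists k; rewrite e.
- move=> X X' [s|_] h h'; apply: sig_ext; apply: set_ext => x.
    by split=> [/h /h'|/h' /h].
  by split=> [/h|/h'].
Qed.

(** * The three statements for regular cardinals above [beth_omega] *)

Theorem theorem2p1 (T : Type) (lt : T -> T -> Prop) :
  regular_cardinal lt -> card_lt beth_omega T ->
  exists K0 : Type, card_lt K0 beth_omega /\
  forall (K : Type) (ltK : K -> K -> Prop),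
    regular_cardinal ltK -> card_le K0 K -> card_lt K beth_omega ->
    let S := S_cof lt K in
    (* (1) *)
    (card_eq (exp_lt T ltK) T ->
      exists P : T -> (T -> Prop) -> Prop,
        (forall d, S d -> good_family lt (P d) d K) /\
        (forall A : T -> Prop, card_le T {x | A x} ->
           stationary lt (fun d => S d /\
             exists X, P d X /\ subset X A /\ sup_eq lt X d))) /\
    (* (2) *)
    (exists P0 : T -> (T -> Prop) -> Prop,
        (forall d, S d -> good_family lt (P0 d) d K) /\
        (forall A : T -> Prop, card_le T {x | A x} ->
           exists E, club lt E /\
             forall d, E d -> S d ->
               exists a, P0 d a /\ sup_eq lt (fun x => A x /\ a x) d)) /\
    (* (3) *)
    ((forall Th : Type, card_lt Th T -> card_lt (exp_lt Th ltK) T) ->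
      exists R : T -> (T -> Prop) -> Prop,
        (forall d, S d -> good_family lt (R d) d K) /\
        (forall a : T -> T -> Prop,
           (forall d, S d -> subset (a d) (fun b => lt b d) /\ otype_le lt (a d) ltK) ->
           exists C, club lt C /\ forall d, C d -> S d -> R d (a d))).
Proof.
move=> reg big; have [n hn] := uniform_covers _ _ reg big.
have [K1 [sK1 hK1]] := power_bound T.
(* The first summand is the threshold of [guess] for (1) and (2), the second that of [power_bound]
   for (3). *)
exists (beth_type (S n) + K1)%type; split.
  by apply/small_lt_omega/small_sum => //; exists (S n); apply: card_le_refl.
move=> K ltK regK leK /lt_omega_small sK S.
have leK1 : card_le (beth_type (Datatypes.S n)) K.
  by apply: card_le_trans _ leK; exists inl => x y [].
have leK2 : card_le K1 K.
  by apply: card_le_trans _ leK; exists inr => x y [].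
have [P hP] : exists P : T -> (T -> Prop) -> Prop, forall d, good_family lt (P d) d K /\
    forall u : K -> T, (forall k, lt (u k) d) ->
      exists a : beth_type n -> T -> Prop, (forall k, exists i, a i (u k)) /\
        forall i X, (forall x, X x -> a i x /\ lt x d) -> card_le {x | X x} K -> P d X.
  apply: (functional_choice (fun d (P : (T -> Prop) -> Prop) => good_family lt P d K /\
    forall u : K -> T, (forall k, lt (u k) d) ->
      exists a : beth_type n -> T -> Prop, (forall k, exists i, a i (u k)) /\
        forall i X, (forall x, X x -> a i x /\ lt x d) -> card_le {x | X x} K -> P X)).
  by move=> d; have [d' [dd' cov]] := hn d; apply: (family_exists _ _ reg big n K d d').
have guessP A d : S d -> (forall b, lt b d -> exists x, A x /\ lt b x /\ lt x d) ->
    exists X, P d X /\ subset X A /\ sup_eq lt X d.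
  move=> Sd hA; have [_ hPd] := hP d; exact: (guess _ _ reg n K ltK d A (P d)).
split; [|split].
- move=> _; exists P; split=> [d _|A hA C clC]; first by have [] := hP d.
  have [d [Cd [Sd hd]]] := cof_stationary _ _ reg big K ltK A C regK sK hA clC.
  by exists d; split=> //; split=> //; apply: guessP.
- exists P; split=> [d _|A hA]; first by have [] := hP d.
  (* The club is the set of limit points of [A]. *)
  eexists; split; first apply: (limit_points_club _ _ reg A _ hA).
    by apply: (small_few _ big); exists 0; apply: card_le_refl.
  move=> d hd Sd; have [X [PX [XA [le_d sup_d]]]] := guessP A d Sd hd.
  exists X; split=> //; split=> [x [_ /le_d //]|b /sup_d [x [Xx bx]]].
  by exists x; split=> //; split=> //; apply: XA.
(* All small subsets of [d] are listed: there are few of them by [power_bound] applied to the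
   segment below [d]. The club can then be all of [T]. *)
- move=> H; exists (fun d X => small_subset_of lt X d K); split=> [d _|a ha].
    split=> //; apply: small_subsets_few => //.
    by apply: (hK1 K ltK) => //; apply/card_lt_of_not_le/(not_le_below _ _ reg).
  exists (fun _ => True); split.
    by split=> // b; exists b; split=> //; right.
  move=> d _ Sd; have [sub [f hf]] := ha d Sd; split=> //; exists f => x y e.
  have [irrK _] := reg_wellorder _ _ regK.
  have [_ [_ [tot _]]] := reg_wellorder _ _ reg.
  case: (tot (proj1_sig x) (proj1_sig y)) => [/hf|[/sig_ext //|/hf]]; by rewrite e => /irrK.
Qed.
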